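(* Let $\beta\in\mathbb{R}_{>1}$ and $J\in\mathbb{Z}\cup\{-\infty\}$. Let $\rho\approx 1.3247$ be the real solution of $x^3-x-1=0$, and let $MB$ be the set of $\beta>1$ whose greedy expansion of unity $d_\beta(1)=d_1d_2\ldots$ satisfies $d_k\geq d_{k+1}$ for all $k\in\mathbb{Z}_{\geq 1}$. (a) If $\beta\in\{\rho\}\cup MB$, then $\bar{d}(\beta)=\bar{d}^{(\beta E)}(\beta)$. (b) If $\beta\notin\{\rho\}\cup MB$, then there exists $u\in\mathbb{R}_{>0}$ such that $\bar{d}_J(\beta,u)<\bar{d}_J^{(\beta E)}(\beta,u)$.
   Context: Digit sequences. For $J\in\mathbb{Z}\cup\{-\infty\}$, let $\mathcal{D}_J$ be the set of sequences $\{d_j\}_{j\ge J}$ (indexed by integers $j\geq J$, or by all integers if $J=-\infty$) with $d_j\in\mathbb{Z}_{\geq 0}$ and, if $J=-\infty$, with only finitely many nonzero $d_j$ for negative $j$. No a priori bound on the digits is imposed. A beta representation of $u\in\mathbb{R}_{>0}$ in base $\beta\in\mathbb{R}_{>1}$ is a sequence $\{d_j\}\in\mathcal{D}_J$ with $u=\sum_{j=J}^\infty d_j\beta^{-j}$ (convergent). Minimal average digit. Define $$\bar{d}_J(\beta,u)=\inf_{\{d_j\}\in\mathcal{D}_J}\Big\{\limsup_{k\to\infty}\frac1k\sum_{j=J}^{k}d_j \;:\; u=\sum_{j=J}^\infty\frac{d_j}{\beta^j}\Big\},\qquad \bar{d}(\beta)=\sup_{u\in\mathbb{R}_{>0}}\bar{d}_J(\beta,u).$$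 The value $\bar d(\beta)$ does not depend on the choice of $J$. Beta expansion (greedy). The beta expansion of $u$ starting at $J$ is the unique beta representation $\{d_j\}_{j\geq J}$ of $u$ such that the remainders $r_k=u-\sum_{j=J}^k d_j\beta^{-j}$ satisfy $0\leq r_k<\beta^{-k}$ for all $k\geq J$ (all $k\in\mathbb{Z}$ if $J=-\infty$). Its $j$th digit is denoted $d_{j,J}^{(\beta E)}(\beta,u)$. Define $$\bar{d}^{(\beta E)}_J(\beta,u)=\limsup_{k\to\infty}\frac1k\sum_{j=J}^k d_{j,J}^{(\beta E)}(\beta,u),\qquad \bar{d}^{(\beta E)}(\beta)=\sup_{u\in\mathbb{R}_{>0}}\bar{d}^{(\beta E)}_J(\beta,u).$$ Expansion of unity. $d_\beta(1)=d_1d_2\ldots$ denotes the beta expansion of $u=1$ starting at $J=1$ (so e.g. $d_\beta(1)=\beta$, i.e. $d_1=\beta$ and all later digits $0$, if $\beta$ is an integer $\ge 2$). If only finitely many digits are nonzero the trailing zeros are omitted in writing, but in the monotonicity condition defining $MB$ they count as digits $0$. *)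

(* Defs.v *)
From mathcomp Require Import all_boot all_order all_algebra.
From mathcomp Require Import all_classical all_reals all_analysis.

Set Implicit Arguments.
Unset Strict Implicit.
Unset Printing Implicit Defensive.

Import Order.TTheory GRing.Theory Num.Theory.
Import numFieldNormedType.Exports.

Local Open Scope classical_set_scope.
Local Open Scope ring_scope.

(* A starting index J in Z \cup {-oo} is an [option int], [None] being -oo. *)
Definition from (J : option int) : set int :=
  if J is Some m then [set j | m <= j] else setT.

(* A sequence (d_j)_{j >= J} is extended by 0 to all integers, so that equality
   of sequences over j >= J is Leibniz equality. *)
Definition digit_seq (J : option int) (d : int -> nat) : Prop :=
  if J is Some m then forall j : int, j < m -> d j = 0%N
  else finite_set [set j : int | j < 0 /\ d j <> 0%N].

(* \sum_{j = J}^k f_j, for J = -oo too: [\sum_(_ \in _)] is the sum over the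
   support of f, which [digit_seq] makes finite below k. *)
Definition sum_upto (V : nmodType) (J : option int) (f : int -> V) (k : int) :
    V := \sum_(j \in [set j | from J j /\ j <= k]) f j.

Section BetaRepresentations.
Variable R : realType.
Implicit Types (J : option int) (beta u : R) (d : int -> nat).

Definition beta_sum J beta d (k : int) : R :=
  sum_upto J (fun j => (d j)%:R * beta ^ (- j)) k.

Definition beta_representation J beta u d : Prop :=
  digit_seq J d /\ beta_sum J beta d n%:Z @[n --> \oo] --> u.

(* It takes values in the extended reals since digits may be unbounded; the
   value of the quotient at k = 0 is irrelevant to the limsup. *)
Definition average_digit J d : \bar R :=
  limn_esup (fun k : nat => ((sum_upto J d k%:Z)%:R / k%:R : R)%:E).

Definition min_average_digit_at J beta u : \bar R :=
  ereal_inf [set average_digit J d | d in beta_representation J beta u].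

Definition min_average_digit J beta : \bar R :=
  ereal_sup [set min_average_digit_at J beta u | u in [set u : R | 0 < u]].

Definition is_beta_expansion J beta u d : Prop :=
  beta_representation J beta u d /\
  forall k : int, from J k -> 0 <= u - beta_sum J beta d k < beta ^ (- k).

(* The beta expansion is the unique element of the set below when 1 < beta and
   0 < u; the zero sequence is a junk default outside that range. *)
Definition beta_expansion J beta u : int -> nat :=
  xget (fun=> 0%N) [set d | is_beta_expansion J beta u d].

Definition expansion_average_digit_at J beta u : \bar R :=
  average_digit J (beta_expansion J beta u).

Definition expansion_average_digit J beta : \bar R :=
  ereal_sup
    [set expansion_average_digit_at J beta u | u in [set u : R | 0 < u]].

Definition expansion_of_unity beta : int -> nat :=
  beta_expansion (Some 1) beta 1.

Definition MB : set R :=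
  [set beta | 1 < beta /\
     forall k : int, 1 <= k ->
       (expansion_of_unity beta (k + 1) <= expansion_of_unity beta k)%N].

End BetaRepresentations.

Arguments MB : clear implicits.

(* Main.v *)
(**
  Call beta reducible if the greedy expansion of every finite sum of N powers
  of beta is finite with digit sum at most N.

  If beta is reducible, truncate any representation of u after n digits and
  reduce the truncation; comparing with the greedy digits of u at the first
  difference shows that no representation has a smaller average digit.
  Reducibility follows from a carry property: among the representations of a
  sum by at most N powers take one with the largest possible leading exponent,
  and induct.  If the expansion of unity t is nonincreasing, carries come from
  beta + \sum_(i >= 1) (t_i - t_(i+1)) beta^-i = t_1 + 1, a relation with
  nonnegative coefficients; for rho they come from reducing the sums of two
  powers rho^i + rho^j with |i - j| <= 4.

  Conversely, if beta is reducible and beta^2 > floor(beta) + 1, reducing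
  floor(beta) + 1 yields a relation of the above kind, hence a nonincreasing
  expansion of unity; if beta^2 <= 2, reducing two sums 1 + beta^-i forces
  beta = rho.

  If beta is not reducible, some sum x of N powers has more than N greedy
  digits.  Scaled copies of x are placed again and again, each as soon as the
  greedy remainder of the previous ones is negligible.  The digits emitted in
  between are free, so the greedy expansion of the total gains at least one
  digit on the placed powers in every window of bounded length.
*)
Require Import Defs.
From mathcomp Require Import all_boot all_order all_algebra.
From mathcomp Require Import all_classical all_reals all_analysis.
From mathcomp Require Import zify ring lra.

Set Implicit Arguments.
Unset Strict Implicit.
Unset Printing Implicit Defensive.

Import Order.TTheory GRing.Theory Num.Theory.
Import numFieldNormedType.Exports.

Local Open Scope classical_set_scope.
Local Open Scope ring_scope.

(** * Multisets of powers of the base *)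

(** Two obstacles shape the proof. Competing representations have no bound on their digits, so the
    tail left after k digits need not be O(beta^-k); a representation is therefore truncated a fixed
    number of places beyond k, which makes the scaled tail a small multiple of k. In bases that are
    not reducible the emitted digits must be final: when the remainder is very close to 1, powers
    placed later could carry into digits already emitted. Such a remainder is pushed past 1 at once
    by one extra power, paid for by one extra digit, and the parameters are tuned so that a genuine
    gain comes before the next push or together with it. Finally, for finite J the first greedy
    digit can be arbitrarily large, so for reducible bases only the suprema are compared, and u is
    replaced by what is left after its first digit. *)

Section PowerSums.
Variables (R : realType) (beta : R).

(* A multiset of powers of [beta] is the list of its exponents. *)
Definition power_sum (s : seq int) : R := \sum_(e <- s) beta ^ e.

Definition greedy (s : seq int) : Prop :=
  forall k : int, \sum_(e <- s | e < k) beta ^ e < beta ^ k.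

Definition greedy_reducible : Prop :=
  forall s, exists s', [/\ greedy s', power_sum s' = power_sum s
                         & (size s' <= size s)%N].

Definition carry_property : Prop :=
  forall (s : seq int) (p : int), greedy s -> (forall e, e \in s -> e <= p) ->
    beta ^ (p + 1) <= power_sum (p :: s) ->
    exists s', [/\ power_sum s' = power_sum (p :: s),
      (size s' <= (size s).+1)%N & exists2 e, e \in s' & p + 1 <= e].

Hypothesis beta_gt1 : 1 < beta.

Lemma beta_gt0 : 0 < beta.
Proof. exact: lt_trans beta_gt1. Qed.

Lemma beta_neq0 : beta != 0.
Proof. by rewrite gt_eqF ?beta_gt0. Qed.

Lemma expz_gt0 (e : int) : 0 < beta ^ e.
Proof. exact/exprz_gt0/beta_gt0. Qed.

Lemma expzD (m n : int) : beta ^ (m + n) = beta ^ m * beta ^ n.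
Proof. by rewrite expfzDr ?beta_neq0. Qed.

Lemma expr_unbounded (M : R) : exists n : nat, M < beta ^+ n.
Proof.
have h0 : 0 < beta - 1 by rewrite subr_gt0.
have bern n : 1 + n%:R * (beta - 1) <= beta ^+ n.
  elim: n => [|n IH]; first by rewrite mul0r addr0 expr0.
  rewrite exprS -natr1.
  have := ler_wpM2l (ltW beta_gt0) IH.
  apply: le_trans.
  have : 0 <= n%:R * ((beta - 1) * (beta - 1)) by rewrite !mulr_ge0 // ltW.
  lra.
exists (Num.bound `|M / (beta - 1)|).
apply: lt_le_trans (bern _).
have := le_lt_trans (ler_norm _) (archi_boundP (normr_ge0 (M / (beta - 1)))).
by rewrite ltr_pdivrMr // => h; lra.
Qed.

Lemma power_sum_cons p s : power_sum (p :: s) = beta ^ p + power_sum s.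
Proof. by rewrite /power_sum big_cons. Qed.

Lemma power_sum_cat s t : power_sum (s ++ t) = power_sum s + power_sum t.
Proof. by rewrite /power_sum big_cat. Qed.

Lemma power_sum_perm s t : perm_eq s t -> power_sum s = power_sum t.
Proof. by move=> h; apply: perm_big. Qed.

Lemma power_sum_ge0 s : 0 <= power_sum s.
Proof. by apply: sumr_ge0 => e _; rewrite ltW ?expz_gt0. Qed.

Lemma mem_power_sum e s : e \in s -> beta ^ e <= power_sum s.
Proof.
move=> he; rewrite (power_sum_perm (perm_to_rem he)) power_sum_cons.
by rewrite lerDl power_sum_ge0.
Qed.

Lemma int_set_max (P : int -> Prop) (B : int) :
  (exists e, P e) -> (forall e, P e -> e <= B) ->
  exists2 m, P m & forall e, P e -> e <= m.
Proof.
move=> [e0 Pe0] hB.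
have [n] : exists n : nat, `[< P (B - n%:Z) >].
  exists `|B - e0|%N; apply/asboolP.
  have -> : B - `|B - e0|%N%:Z = e0 by have := hB _ Pe0; lia.
  exact: Pe0.
move=> hn; have ex : exists n : nat, `[< P (B - n%:Z) >] by exists n.
case: (ex_minnP ex) => m /asboolP Pm hmin.
exists (B - m%:Z) => // e Pe.
have := hB _ Pe => le; have : `[< P (B - (`|B - e|%N)%:Z) >].
  apply/asboolP; have -> : B - `|B - e|%N%:Z = e by lia.
  exact: Pe.
by move=> /hmin; lia.
Qed.

Lemma greedy_nil : greedy [::].
Proof. by move=> k; rewrite big_nil expz_gt0. Qed.

(* Among the representations with at most as many powers, take one whose
   largest exponent p is maximal and reduce the rest: the carry property says
   precisely that the result is then greedy at p as well. *)
Lemma carry_greedy_reducible : carry_property -> greedy_reducible.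
Proof.
move=> carry s.
suff [s' [? ? ?]] : exists s', [/\ greedy s', power_sum s' = power_sum s
                      & (size s' <= size s)%N] by exists s'.
move: {2 3}(size s) (leqnn (size s)) => N.
elim: N s => [|N IH] s hs.
  exists [::]; split; [exact: greedy_nil | | by []].
  by move: hs; rewrite leqn0 size_eq0 => /eqP ->.
have [s0|s_neq0] := eqVneq s [::].
  by exists [::]; rewrite s0; split; first exact: greedy_nil.
pose P e := exists s1, [/\ e \in s1, power_sum s1 = power_sum s
                         & (size s1 <= N.+1)%N].
have exP : exists e, P e.
  case: s s_neq0 hs @P => // e s _ hs P; exists e, (e :: s).
  by rewrite mem_head.
have [B hB] := expr_unbounded (power_sum s).
have [e Pe|p [s1 [ps1 vs1 ss1]] maxp] := @int_set_max P B%:Z exP.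
  have [s1 [/mem_power_sum h1 h2 _]] := Pe.
  rewrite -(ler_eXz2l beta_gt1); apply: le_trans h1 _.
  by rewrite h2; apply/ltW.
have perm1 := perm_to_rem ps1.
have size1 : size s1 = (size (rem p s1)).+1 by rewrite (perm_size perm1).
have [s2 [g2 v2 sz2]] := IH (rem p s1) ltac:(by rewrite -ltnS -size1).
have vp2 : power_sum (p :: s2) = power_sum s.
  by rewrite power_sum_cons v2 -power_sum_cons -vs1 -(power_sum_perm perm1).
have le_p e : e \in p :: s2 -> e <= p.
  by move=> he; apply: maxp; exists (p :: s2).
have [lt_p|ge_p] := ltP (power_sum s) (beta ^ (p + 1)).
  exists (p :: s2); split=> // k; rewrite big_cons.
  case: (ltP p k) => hk; last exact: g2.
  apply: lt_le_trans (_ : beta ^ (p + 1) <= _); last first.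
    by rewrite ler_eXz2l //; lia.
  apply: le_lt_trans lt_p; rewrite -vp2 power_sum_cons lerD2l /power_sum.
  rewrite [leRHS](bigID (fun e => e < k)) /= lerDl.
  by apply: sumr_ge0 => e _; rewrite ltW ?expz_gt0.
case: (@carry s2 p) => // [e he||s3 [v3 sz3 [e e3 pe]]].
- by apply: le_p; rewrite inE he orbT.
- by rewrite vp2.
- have /maxp : P e.
    by exists s3; rewrite v3 vp2 (leq_trans sz3).
  lia.
Qed.

(** Here beta - 1 = beta^-4, so the powers other than [p] add up to at least beta^(p-4), and
    greediness of [s] yields an exponent [q] in it with p-4 <= q <= p. According to p - q, the pair
    is rewritten by 2 = beta^2 + beta^-5, 1 + beta^-1 = beta^2, 1 + beta^-2 = beta + beta^-5, 1 +
    beta^-3 = beta + beta^-8 or 1 + beta^-4 = beta. *)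
Lemma carry_property_rho : beta ^+ 3 = beta + 1 -> carry_property.
Proof.
move=> rho3 s p gs les.
have b0 := beta_neq0.
rewrite {1}power_sum_cons expzD expr1z => hv.
have b5 : beta ^+ 5 = beta ^+ 4 + 1.
  have -> : beta ^+ 5 =
    beta ^+ 4 + 1 + (beta ^+ 3 - (beta + 1)) * (beta ^+ 2 - beta + 1) by ring.
  by rewrite rho3 subrr mul0r addr0.
have pw (k : nat) : beta ^ (p - 8) * beta ^+ k = beta ^ (p - 8 + k%:Z).
  by rewrite [RHS]expzD.
(* The lowest exponent in the five rewritings is p-8; relative to it all powers are natural. *)
pose a := beta ^ (p - 8).
have a0 : 0 < a := expz_gt0 _.
have [q qs pq] : exists2 q, q \in s & p - 4 <= q.
  apply: contrapT => hno.
  have : power_sum s < beta ^ (p - 4).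
    rewrite /power_sum big_seq (eq_bigl (fun e => (e \in s) && (e < p - 4))).
      by rewrite -big_seq_cond; apply: gs.
    move=> e; case es : (e \in s) => //=; case: ltP => // ?.
    by exfalso; apply: hno; exists e.
  apply/negP; rewrite -leNgt.
  have Ep4 : beta ^ (p - 4) = a * beta ^+ 4 by rewrite pw; congr (_ ^ _); lia.
  have Ep : beta ^ p = a * beta ^+ 8 by rewrite pw; congr (_ ^ _); lia.
  rewrite Ep4; move: hv; rewrite Ep => hv.
  have : a * beta ^+ 8 * beta - a * beta ^+ 8 = a * beta ^+ 4.
    have -> : a * beta ^+ 8 * beta = a * beta ^+ 4 * beta ^+ 5 by ring.
    by rewrite b5; ring.
  lra.
have := les _ qs.
have perm1 := perm_to_rem qs.
have sz1 : (size (rem q s)).+2 = (size s).+1 by rewrite (perm_size perm1).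
have close t : power_sum t = beta ^ p + beta ^ q -> (size t <= 2)%N ->
    (exists2 e, e \in t & p + 1 <= e) ->
    exists s', [/\ power_sum s' = power_sum (p :: s),
      (size s' <= (size s).+1)%N & exists2 e, e \in s' & p + 1 <= e].
  move=> vt st [e et pe]; exists (t ++ rem q s); split.
  - rewrite power_sum_cat vt power_sum_cons (power_sum_perm perm1).
    by rewrite power_sum_cons addrA.
  - by rewrite size_cat -sz1 -add2n leq_add2r.
  - by exists e; rewrite // mem_cat et.
have r8 (k : nat) : beta ^+ k.+3 = beta ^+ k.+1 + beta ^+ k.
  by rewrite -addn3 exprD rho3 exprS; ring.
move=> qp.
have E (z : int) (k : nat) : z = p - 8 + k%:Z -> beta ^ z = a * beta ^+ k.
  by move=> ->; rewrite pw.
have : q = p \/ q = p - 1 \/ q = p - 2 \/ q = p - 3 \/ q = p - 4 by lia.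
case=> [hq|[hq|[hq|[hq|hq]]]].
- apply: (close [:: p + 2; p - 5]); rewrite ?mem_head //; last first.
    by exists (p + 2); rewrite ?mem_head //; lia.
  rewrite /power_sum !big_cons big_nil (@E (p + 2) 10) ?(@E (p - 5) 3)
    ?(@E p 8) ?(@E q 8); try lia.
  by rewrite !r8; ring.
- apply: (close [:: p + 2]); rewrite ?mem_head //; last first.
    by exists (p + 2); rewrite ?mem_head //; lia.
  rewrite /power_sum !big_cons big_nil (@E (p + 2) 10) ?(@E p 8) ?(@E q 7);
    try lia.
  by rewrite !r8; ring.
- apply: (close [:: p + 1; p - 5]); rewrite ?mem_head //; last first.
    by exists (p + 1); rewrite ?mem_head //; lia.
  rewrite /power_sum !big_cons big_nil (@E (p + 1) 9) ?(@E (p - 5) 3)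
    ?(@E p 8) ?(@E q 6); try lia.
  by rewrite !r8; ring.
- apply: (close [:: p + 1; p - 8]); rewrite ?mem_head //; last first.
    by exists (p + 1); rewrite ?mem_head //; lia.
  rewrite /power_sum !big_cons big_nil (@E (p + 1) 9) ?(@E (p - 8) 0)
    ?(@E p 8) ?(@E q 5); try lia.
  by rewrite !r8; ring.
- apply: (close [:: p + 1]); rewrite ?mem_head //; last first.
    by exists (p + 1); rewrite ?mem_head //; lia.
  rewrite /power_sum !big_cons big_nil (@E (p + 1) 9) ?(@E p 8) ?(@E q 4);
    try lia.
  by rewrite !r8; ring.
Qed.

End PowerSums.

(** * Nonincreasing expansions of unity *)

(** The target is an arbitrary monoid so that one splitting serves for values and, with [F]
    constantly 1 in nat, for lengths. *)
Lemma digits_split (V : nmodType) (F : int -> V) (L : seq int) (p : int) n :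
  (forall e, e \in L -> e <= p) ->
  \sum_(e <- L) F e =
  \sum_(l < n) F (p - l%:Z) *+ count_mem (p - l%:Z) L
  + \sum_(e <- L | e <= p - n%:Z) F e.
Proof.
move=> hL; elim: n => [|n IH].
  rewrite big_ord0 add0r big_seq [RHS]big_seq_cond; apply: eq_bigl => e.
  by case he : (e \in L) => //=; rewrite subr0 hL.
rewrite IH big_ord_recr /= -addrA; congr (_ + _).
rewrite (bigID (fun e => e == p - n%:Z)) /=; congr (_ + _); last first.
  by apply: eq_bigl => e; lia.
rewrite (eq_bigl (fun e => e == p - n%:Z)); last by move=> e; lia.
rewrite (eq_bigr (fun _ => F (p - n%:Z))); last by move=> e /eqP ->.
by rewrite big_const_seq iter_addr_0.
Qed.

Section UnityData.
Variables (R : realType) (beta : R).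

(* The relation t1 + 1 = beta + \sum_(j in ps) beta^-j, with at most t1 terms
   in the sum, has the coefficient sequence of (X - 1) times the one of the
   expansion of unity with digits [unity_digit t1 ps]; nonnegativity of the
   coefficients of the former is monotonicity of the latter. *)
Definition unity_data (t1 : nat) (ps : seq nat) : Prop :=
  [/\ forall j, j \in ps -> (0 < j)%N, (size ps <= t1)%N
    & t1.+1%:R = beta + \sum_(j <- ps) beta ^- j].

Definition unity_digit (t1 : nat) (ps : seq nat) (l : nat) : nat :=
  (t1 - size ps + count (leq l) ps)%N.

(** Closed form of the tail \sum_(l > i) t_l beta^-l for the digits t_l given by [unity_digit]:
    their constant part gives a geometric series, and each [j] adds 1 to the digits with l <= j.
    Truncated subtraction makes every j <= i contribute 0. *)
Definition unity_remainder (t1 : nat) (ps : seq nat) (i : nat) : R :=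
  beta ^- i * ((t1 - size ps)%:R + \sum_(j <- ps) (1 - beta ^- (j - i)))
  / (beta - 1).

Hypothesis beta_gt1 : 1 < beta.
Let beta_gt0 : 0 < beta := beta_gt0 beta_gt1.
Let beta_neq0 : beta != 0 := beta_neq0 beta_gt1.

Lemma beta_sub1_gt0 : 0 < beta - 1. Proof. by rewrite subr_gt0. Qed.

Lemma expVn_gt0 n : 0 < beta ^- n.
Proof. by rewrite invr_gt0 exprn_gt0. Qed.

Lemma expVn_le1 n : beta ^- n <= 1.
Proof. by rewrite invf_le1 ?exprn_gt0 // exprn_ege1 // ltW. Qed.

Lemma expzBn (p : int) (n : nat) : beta ^ (p - n%:Z) = beta ^ p * beta ^- n.
Proof. by rewrite expzD // -invr_expz. Qed.

Lemma unity_remainder_ge0 t1 ps i : 0 <= unity_remainder t1 ps i.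
Proof.
rewrite /unity_remainder !mulr_ge0 ?invr_ge0 ?(ltW beta_sub1_gt0) //.
  by rewrite exprn_ge0 // ltW.
by rewrite addr_ge0 ?ler0n // sumr_ge0 // => j _; rewrite subr_ge0 expVn_le1.
Qed.

Lemma unity_remainder0 t1 ps : unity_data t1 ps -> unity_remainder t1 ps 0 = 1.
Proof.
move=> [_ sz eq1]; rewrite /unity_remainder expr0 invr1 mul1r.
rewrite (eq_bigr (fun j => 1 - beta ^- j)); last by move=> j _; rewrite subn0.
rewrite sumrB big_const_seq count_predT iter_addr_0 natrB //.
have /eqP := eq1; rewrite -natr1 eq_sym -subr_eq => /eqP eq2.
rewrite (_ : _ + _ = beta - 1) ?divff ?gt_eqF ?beta_sub1_gt0 //.
by move: eq2; set S := \sum_(_ <- _) _ => eq2; rewrite -eq2; ring.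
Qed.

Lemma unity_remainderS t1 ps i : unity_remainder t1 ps i =
  (unity_digit t1 ps i.+1)%:R * beta ^- i.+1 + unity_remainder t1 ps i.+1.
Proof.
have b1 := beta_sub1_gt0.
have bi : beta ^- i = beta ^- i.+1 * beta.
  by rewrite exprSr invfM -mulrA mulVf ?mulr1 ?beta_neq0.
rewrite /unity_remainder bi /unity_digit natrD.
have -> : (count (leq i.+1) ps)%:R =
    \sum_(j <- ps) (if (i < j)%N then 1 else 0) :> R.
  by rewrite -sum1_count natr_sum big_mkcond.
set c := (t1 - size ps)%:R.
suff -> : \sum_(j <- ps) (1 - beta ^- (j - i)) =
  (\sum_(j <- ps) (1 - beta ^- (j - i.+1)) + (beta - 1) *
    \sum_(j <- ps) (if (i < j)%N then 1 else 0)) / beta.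
  by field; rewrite beta_neq0 expf_neq0 // gt_eqF.
rewrite mulr_sumr -big_split mulr_suml; apply: eq_bigr => j _ /=.
case: ltnP => hj.
  have -> : (j - i = (j - i.+1).+1)%N by lia.
  by rewrite exprS; field; rewrite beta_neq0 expf_neq0.
have -> : (j - i = 0)%N by lia.
have -> : (j - i.+1 = 0)%N by lia.
by rewrite expr0 invr1 subrr mulr0 addr0 mul0r.
Qed.

Lemma unity_partial_sum t1 ps i : unity_data t1 ps ->
  \sum_(l < i) (unity_digit t1 ps l.+1)%:R * beta ^- l.+1 =
  1 - unity_remainder t1 ps i.
Proof.
move=> h; elim: i => [|i IH]; first by rewrite big_ord0 unity_remainder0 // subrr.
by rewrite big_ord_recr /= IH (unity_remainderS _ _ i); ring.
Qed.

(** Passing from 0 to i > 0 strictly lowers every term 1 - beta^-(j-i), since j > 0, and at 0 the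
    remainder is 1. For empty [ps] the digits are constantly t1 = beta - 1 and the remainder equals
    beta^-i: the expansion of 1 in an integer base that is not greedy. *)
Lemma unity_remainder_lt t1 ps i : unity_data t1 ps -> ps != [::] -> (0 < i)%N ->
  unity_remainder t1 ps i < beta ^- i.
Proof.
move=> h ps0 i0; have := unity_remainder0 h.
have [pos _ _] := h; have b1 := beta_sub1_gt0.
rewrite /unity_remainder expr0 invr1 mul1r => /divr1_eq.
set c := (t1 - size ps)%:R => e1.
rewrite -mulrA -[ltRHS]mulr1 ltr_pM2l ?expVn_gt0 //.
rewrite ltr_pdivrMr // mul1r -e1 ltrD2l.
have hlt j : j \in ps -> beta ^- (j - 0) < beta ^- (j - i).
  move=> /pos j0; rewrite ltf_pV2 ?posrE ?exprn_gt0 // ltr_eXn2l //.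
  by lia.
rewrite !sumrB ltrD2l ltrN2.
case: ps ps0 hlt {h pos c e1} => // j ps _ hlt; rewrite !big_cons.
apply: ltr_leD; first by apply: hlt; rewrite mem_head.
rewrite !big_seq; apply: ler_sum => k hk.
by rewrite ltW // hlt // inE hk orbT.
Qed.

Lemma sum_geometric (q : int) a m :
  \sum_(l <- iota a.+1 m) beta ^ (q - l%:Z) =
  beta ^ q * (beta ^- a - beta ^- (a + m)) / (beta - 1).
Proof.
elim: m a => [|m IH] a; first by rewrite big_nil addn0 subrr mulr0 mul0r.
rewrite /= big_cons IH addSnnS.
rewrite expzBn exprS.
field; rewrite gt_eqF ?beta_sub1_gt0 //= ?beta_neq0 ?expf_neq0 //.
Qed.

(** The multiplicities in p :: s, read from [p] downwards, are compared with the expansion of unity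
    scaled to beta^(p+1). If they agree, the sum is exactly beta^(p+1). If the first different one
    is smaller, greediness of [s] below it keeps the sum under beta^(p+1). If it is larger, the
    digits of unity up to that place, plus one unit of the surplus, are exchanged for beta^(p+1) and
    some lower powers. *)
Lemma unity_carry_property t1 ps : unity_data t1 ps -> carry_property beta.
Proof.
move=> data s p gs les ge_p1.
have [pos sz eq1] := data.
have b0 := beta_gt0; have b1 := beta_sub1_gt0.
pose f l := unity_digit t1 ps l; pose L := p :: s.
pose d l := count_mem (p - l%:Z) L.
have leL e : e \in L -> e <= p.
  by rewrite inE => /orP[/eqP ->//|]; apply: les.
have psplit n : power_sum beta L = \sum_(l < n) (d l)%:R * beta ^ (p - l%:Z)
     + \sum_(e <- L | e <= p - n%:Z) beta ^ e.
  rewrite /power_sum (digits_split _ n leL); congr (_ + _).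
  by apply: eq_bigr => l _; rewrite mulr_natl.
have ssplit n : size L = (\sum_(l < n) d l + count (fun e => (e <= p - n%:Z)%R) L)%N.
  rewrite -sum1_size (@digits_split nat (fun=> 1%N) L p n leL) sum1_count.
  by congr (_ + _)%N; apply: eq_bigr => l _; rewrite -[RHS]natn.
have shift l : beta ^ (p - l%:Z) = beta ^ (p + 1) * beta ^- l.+1.
  by rewrite -expzBn; congr (_ ^ _); lia.
have fsum n : \sum_(l < n) (f l.+1)%:R * beta ^ (p - l%:Z) =
    beta ^ (p + 1) * (1 - unity_remainder t1 ps n).
  rewrite -(unity_partial_sum n data) mulr_sumr; apply: eq_bigr => l _.
  by rewrite shift mulrCA.
have [[i0 hi0]|hno] := pselect (exists i, d i != f i.+1); last first.
  exists [:: p + 1]; split; [|by []|by exists (p + 1); rewrite ?mem_head].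
  rewrite /power_sum big_seq1; apply/eqP; rewrite eq_le ge_p1 /=.
  have [n hn] : exists n : nat, forall e, e \in L -> ~~ (e <= p - n%:Z).
    elim: (L) => [|e L' [n IH]]; first by exists 0%N.
    exists (n + `|p - e|.+1)%N => e'; rewrite inE => /orP[/eqP ->|/IH]; lia.
  rewrite -[X in X <= _]/(power_sum beta L) (psplit n).
  rewrite [X in _ + X]big_seq_cond [X in _ + X]big1; last first.
    by move=> e /andP[/hn /negbTE ->].
  rewrite addr0 (eq_bigr (fun l : 'I_n => (f l.+1)%:R * beta ^ (p - l%:Z))).
    rewrite fsum ger_pMr ?expz_gt0 // gerBl.
    exact: unity_remainder_ge0.
  move=> l _; congr (_%:R * _); apply/eqP/negPn/negP => hl.
  by apply: hno; exists l.
have ex : exists i, d i != f i.+1 by exists i0.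
case: (ex_minnP ex) => i hi hmin {i0 hi0 ex}.
have deq l : (l < i)%N -> d l = f l.+1.
  by move=> li; apply/eqP/negPn/negP => /hmin; lia.
have dsum : \sum_(l < i.+1) (d l)%:R * beta ^ (p - l%:Z) =
    beta ^ (p + 1) * (1 - unity_remainder t1 ps i.+1)
    + (d i)%:R * beta ^ (p - i%:Z) - (f i.+1)%:R * beta ^ (p - i%:Z).
  rewrite -fsum !big_ord_recr /=.
  rewrite (eq_bigr (fun l : 'I_i => (f l.+1)%:R * beta ^ (p - l%:Z))).
    by ring.
  by move=> l _; rewrite deq.
have rem_ge0 := unity_remainder_ge0 t1 ps i.+1.
have pp0 := expz_gt0 beta_gt1 (p + 1).
have pi0 := expz_gt0 beta_gt1 (p - i%:Z).
have tailE : \sum_(e <- L | e <= p - i.+1%:Z) beta ^ e =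
             \sum_(e <- s | e < p - i%:Z) beta ^ e.
  rewrite big_cons; case: ifP => hp; first by exfalso; lia.
  by apply: eq_bigl => e; lia.
have [lt_df|lt_fd] : (d i < f i.+1)%N \/ (f i.+1 < d i)%N by lia.
  exfalso; move: ge_p1; rewrite -/L (psplit i.+1) dsum tailE.
  have tl := gs (p - i%:Z).
  have hf : (d i)%:R + 1 <= (f i.+1)%:R :> R.
    by rewrite natr1 ler_nat.
  have := ler_wpM2r (ltW pi0) hf.
  have : 0 <= beta ^ (p + 1) * unity_remainder t1 ps i.+1.
    by rewrite mulr_ge0 // ltW.
  lra.
pose I := i.+1.
(* [Z] has to make up for beta^(p+1-I) - beta^(p+1) r, with r the remainder of unity after I digits.
   Substituting beta - 1 = t1 - size ps + \sum_j (1 - beta^-j) turns this into a block of min(j, I)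
   consecutive powers for each [j]. *)
pose Z := flatten [seq [seq p + 1 - I%:Z - l%:Z | l <- iota (j - I).+1 (j - (j - I))]
                     | j <- ps].
pose s' := (p + 1) :: nseq (d i - f I - 1) (p - i%:Z)
             ++ [seq e <- s | e < p - i%:Z] ++ Z.
exists s'; split; last by exists (p + 1); rewrite ?mem_head.
- rewrite [LHS]power_sum_cons !power_sum_cat -/L (psplit I) tailE dsum.
  have -> : power_sum beta (nseq (d i - f I - 1) (p - i%:Z)) =
      ((d i)%:R - (f I)%:R - 1) * beta ^ (p - i%:Z).
    rewrite /power_sum big_nseq iter_addr_0 -[LHS]mulr_natl; congr (_ * _).
    by rewrite -subnDA natrB ?natrD ?opprD ?addrA // addn1.
  have -> : power_sum beta [seq e <- s | e < p - i%:Z] =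
      \sum_(e <- s | e < p - i%:Z) beta ^ e.
    by rewrite /power_sum big_filter.
  have -> : power_sum beta Z = beta ^ (p + 1 - I%:Z) *
      (\sum_(j <- ps) (beta ^- (j - I) - beta ^- j)) / (beta - 1).
    rewrite /power_sum big_flatten big_map mulr_sumr mulr_suml.
    apply: eq_bigr => j _; rewrite big_map sum_geometric.
    by have -> : (j - I + (j - (j - I)) = j)%N by lia.
  have := unity_remainder0 data.
  rewrite /unity_remainder expr0 invr1 mul1r => /divr1_eq.
  rewrite (eq_bigr (fun j => 1 - beta ^- j)); last by move=> j _; rewrite subn0.
  have -> : beta ^ (p - i%:Z) = beta ^ (p + 1 - I%:Z) by congr (_ ^ _); lia.
  have -> : beta ^ (p + 1) = beta ^ (p + 1 - I%:Z) * beta ^+ I.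
    by rewrite -[beta ^+ I]/(beta ^ (I%:Z)) -expzD //; congr (_ ^ _); lia.
  rewrite !sumrB; set S0 := \sum_(j <- ps) beta ^- j.
  set S1 := \sum_(j <- ps) beta ^- (j - I).
  set S := \sum_(j <- ps) 1; set c := (t1 - size ps)%:R => e1.
  have -> : S0 = c + S - (beta - 1) by move: e1; lra.
  by rewrite -/I; field; rewrite expf_neq0 // gt_eqF.
(* The sum of min(j, I) counts the pairs of a place l <= I and a [j] with l <= j, which is at most
   the sum of the first I digits of unity; so the exchange does not increase the number of
   powers. *)
- have sZ : (size Z <= \sum_(l < I) f l.+1)%N.
    have -> : size Z = (\sum_(j <- ps) (j - (j - I)))%N.
      rewrite /Z size_flatten /shape -map_comp sumnE big_map.
      by apply: eq_bigr => j _; rewrite /= size_map size_iota.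
    elim: (I) => [|n IH].
      by rewrite big_ord0 big1 // => j _; lia.
    rewrite big_ord_recr /=.
    apply: leq_trans (leq_add IH (leqnn _)).
    rewrite (eq_bigr (fun j => (j - (j - n)) + (n < j))%N); last by move=> j _; lia.
    rewrite big_split leq_add2l /f /unity_digit /= -sum1_count [X in (_ <= _ + X)%N]big_mkcond.
    by rewrite (eq_bigr (fun j => if (n < j)%N then 1%N else 0%N)) ?leq_addl.
  have -> : (size s).+1 = size L by [].
  rewrite (ssplit I) big_ord_recr /=.
  move: sZ; rewrite big_ord_recr /=.
  have -> : (\sum_(l < i) d l = \sum_(l < i) f l.+1)%N.
    by apply: eq_bigr => l _; rewrite deq.
  have -> : (p <= p - I%:Z) = false by lia.
  rewrite !size_cat size_nseq size_filter add0n.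
  have -> : count (fun e => e < p - i%:Z) s = count (fun e => e <= p - I%:Z) s.
    by apply: eq_count => e /=; lia.
  move: lt_fd; rewrite -/I; move: (f I) (d i) (size Z) (count _ s).
  by move: (\sum_(l < i) f l.+1)%N => a b c e g; lia.
Qed.

End UnityData.

(** * Bases in which greedy expansions are shortest *)

Section GreedyReducibleBases.
Variables (R : realType) (beta : R).
Hypotheses (beta_gt1 : 1 < beta) (reducible : greedy_reducible beta).
Let b0 : 0 < beta := beta_gt0 beta_gt1.
Let bn0 : beta != 0 := beta_neq0 beta_gt1.

(** A value in [beta, beta^2) forces the exponent 1 into the greedy form; this is how reducibility
    is turned into relations for beta. *)
Lemma reducible_extract s : beta <= power_sum beta s -> power_sum beta s < beta ^+ 2 ->
  exists r, (size r < size s)%N /\ power_sum beta s = beta + power_sum beta r.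
Proof.
move=> ge_b lt_b2; have [s' [g v sz]] := reducible s.
have [e es e1] : exists2 e, e \in s' & 1 <= e.
  apply: contrapT => hno; have := g 1; rewrite big_seq_cond.
  rewrite (eq_bigl (fun e => e \in s')); last first.
    move=> e; case he : (e \in s') => //=; case: ltP => // ge1.
    by exfalso; apply: hno; exists e.
  by rewrite -big_seq -/(power_sum beta s') v expr1z ltNge ge_b.
have := mem_power_sum beta_gt1 es; rewrite v => le_e.
have := le_lt_trans le_e lt_b2.
rewrite -[beta ^+ 2]/(beta ^ 2%:Z) ltr_eXz2l // => e2.
have ee : e = 1 by lia.
have perm1 := perm_to_rem es; exists (rem e s').
rewrite -v (power_sum_perm _ perm1) power_sum_cons ee expr1z; split=> //.
by rewrite -ee; move: (perm_size perm1) sz => /= ->.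
Qed.

(** The t1 + 1 units reduce to beta and at most t1 further powers; these add up to t1 + 1 - beta < 1
    unless beta is an integer, so their exponents are negative. *)
Lemma reducible_unity_data : (Num.truncn beta).+1%:R < beta ^+ 2 ->
  exists t1 ps, unity_data beta t1 ps /\ ps != [::].
Proof.
set t1 := Num.truncn beta => lt_b2.
have /andP[t1_le lt_t1] : t1%:R <= beta < t1.+1%:R.
  by apply: truncn_itv; apply: ltW.
(* In an integer base the rest is 1, whose exponent 0 is not allowed in [ps]; it is written as beta
   copies of beta^-1. *)
have [eqb|neqb] := eqVneq beta t1%:R.
  have t10 : (0 < t1)%N by rewrite -(ltr_nat R) -eqb.
  exists t1, (nseq t1 1%N); split; last by rewrite -size_eq0 size_nseq -lt0n.
  split; [by move=> j /nseqP[-> _] | by rewrite size_nseq |].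
  rewrite big_nseq iter_addr_0 -[X in _ + X]mulr_natl -eqb expr1 divff //.
  by rewrite -natr1 -eqb.
have vs : power_sum beta (nseq t1.+1 0) = t1.+1%:R.
  by rewrite /power_sum big_nseq iter_addr_0 expr0z.
have [||r [szr vr]] := @reducible_extract (nseq t1.+1 0).
- by rewrite vs ltW.
- by rewrite vs.
rewrite size_nseq ltnS in szr; rewrite vs in vr.
have lt_t1' : t1%:R < beta by rewrite lt_neqAle eq_sym neqb.
have rneg e : e \in r -> e < 0.
  move=> /(mem_power_sum beta_gt1) he; rewrite -(ltr_eXz2l beta_gt1) expr0z.
  apply: le_lt_trans he _; move: vr; rewrite -natr1; lra.
exists t1, [seq `|e|%N | e <- r]; split; last first.
  rewrite -size_eq0 size_map size_eq0; apply/eqP => r0.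
  by move: vr lt_t1; rewrite r0 /power_sum big_nil addr0 => ->; rewrite ltxx.
split; [|by rewrite size_map|].
  by move=> j /mapP[e /rneg he ->]; lia.
rewrite vr big_map /power_sum; congr (_ + _); rewrite [LHS]big_seq [RHS]big_seq.
apply: eq_bigr => e /rneg he.
have {1}-> : e = - `|e|%N%:Z by lia.
by rewrite -invr_expz.
Qed.

(* For i0 minimal with 1 + beta^-i0 < beta^2, both 1 + beta^-i0 and
   1 + beta^-(i0+1) must reduce to beta plus a single power of beta.  The ratio
   of these two powers is at least beta^2, which needs beta^3 >= beta + 1, and
   it cannot be an integral power of beta unless equality holds. *)
Lemma reducible_small_base : beta ^+ 2 <= 2 -> beta ^+ 3 = beta + 1.
Proof.
move=> b2le; have b1 : 0 < beta - 1 by rewrite subr_gt0.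
have b21 : 0 < beta ^+ 2 - 1 by rewrite subr_gt0 exprn_egt1.
(* [P] i is the condition 1 + beta^-i < beta^2. *)
pose P i := 1 < (beta ^+ 2 - 1) * beta ^+ i.
have exP : exists i, P i.
  have [n hn] := expr_unbounded beta_gt1 (beta ^+ 2 - 1)^-1; exists n.
  by rewrite /P mulrC -ltr_pdivrMr // mul1r.
case: (ex_minnP exP) => -[|i0] Pi imin.
  by move: Pi; rewrite /P expr0; lra.
have nPi : (beta ^+ 2 - 1) * beta ^+ i0 <= 1.
  by rewrite leNgt; apply/negP => /imin; rewrite ltnn.
pose X := beta ^+ i0.+1; pose w := (beta - 1) * X.
have X0 : 0 < X by rewrite exprn_gt0.
have w_lb : 1 < w * (beta + 1).
  by move: Pi; rewrite /P -/X /w; congr (_ < _); ring.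
have w_ub : w * (beta + 1) <= beta.
  have := ler_wpM2r (ltW b0) nPi; rewrite mul1r.
  by apply: le_trans; rewrite /w /X exprSr le_eqVlt; apply/orP; left; apply/eqP; ring.
(* The bounds on [W] place 1 + beta^-i strictly between beta and beta^2, so splitting off beta from
   these two powers leaves exactly one; 1 - W is the excess 1 + beta^-i - beta times beta^i. *)
have pair (i : nat) W : W = (beta - 1) * beta ^+ i -> W < 1 -> 1 < W * (beta + 1) ->
    exists a : int, 1 - W = beta ^ a.
  move=> WE W1 Wb; have Y0 : 0 < beta ^+ i by rewrite exprn_gt0.
  have vs : power_sum beta [:: 0; - i%:Z] = 1 + beta ^- i.
    by rewrite /power_sum !big_cons big_nil addr0 expr0z -invr_expz.
  have YV : beta ^+ i * beta ^- i = 1 by rewrite divff ?gt_eqF.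
  have [||r [szr]] := @reducible_extract [:: 0; - i%:Z].
  - rewrite vs -(ler_pM2l Y0) mulrDr YV; have : (beta - 1) * beta ^+ i < 1 by rewrite -WE.
    by lra.
  - rewrite vs -(ltr_pM2l Y0) mulrDr YV; have : 1 < (beta - 1) * beta ^+ i * (beta + 1) by rewrite -WE.
    have -> : (beta - 1) * beta ^+ i * (beta + 1) =
      beta ^+ i * beta ^+ 2 - beta ^+ i by ring.
    by lra.
  rewrite vs => vr.
  have {vr} : 1 - W = beta ^+ i * power_sum beta r.
    have -> : power_sum beta r = 1 + beta ^- i - beta by lra.
    by rewrite mulrBr mulrDr YV WE; ring.
  case: r szr => [|e [|]] // _; rewrite /power_sum ?big_nil ?big_seq1 => hW.
    by exfalso; move: hW; rewrite mulr0; lra.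
  by exists (i%:Z + e); rewrite hW expzD.
have bb0 : 0 < beta + 1 by lra.
have w1 : w < 1 by rewrite -(ltr_pM2r bb0); lra.
have w0 : 0 < w by rewrite mulr_gt0.
have bw1 : beta * w < 1.
  rewrite -(ltr_pM2r bb0) mul1r -mulrA.
  have := ler_wpM2l (ltW b0) w_ub; rewrite -expr2; lra.
have bw_lb : 1 < beta * w * (beta + 1).
  apply: lt_trans w_lb _.
  by rewrite -mulrA ltr_pMl // mulr_gt0.
have [a ha] : exists a : int, 1 - w = beta ^ a by apply: (pair i0.+1).
have [b hb] : exists b : int, 1 - beta * w = beta ^ b.
  by apply: (pair i0.+2) => //; rewrite /w /X [in RHS]exprS; ring.
have zE (n : nat) (z : int) : beta ^ (z + n%:Z) = beta ^ z * beta ^+ n.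
  by rewrite expzD.
have ltb1a : b + 1%N%:Z < a.
  rewrite -(ltr_eXz2l beta_gt1) zE -ha -hb expr1.
  have : 0 < (beta - 1) * (w * (beta + 1) - 1) by rewrite mulr_gt0 ?subr_gt0.
  have -> : (beta - 1) * (w * (beta + 1) - 1) =
    1 - w - (1 - beta * w) * beta by ring.
  lra.
have leb2a : b + 2%N%:Z <= a by clear -ltb1a; lia.
move: (leb2a); rewrite -(ler_eXz2l beta_gt1) zE -ha -hb => le_w.
have w_lb2 : beta + 1 <= w * (beta ^+ 2 + beta + 1).
  rewrite -(ler_pM2l b1); move: le_w.
  have -> : (beta - 1) * (w * (beta ^+ 2 + beta + 1)) = w * (beta ^+ 3 - 1) by ring.
  have -> : (1 - beta * w) * beta ^+ 2 = beta ^+ 2 - w * beta ^+ 3 by ring.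
  have -> : (beta - 1) * (beta + 1) = beta ^+ 2 - 1 by ring.
  lra.
have b3ge : beta + 1 <= beta ^+ 3.
  have D0 : 0 < beta ^+ 2 + beta + 1 by lra.
  have := ler_wpM2r (ltW D0) w_ub.
  have := ler_wpM2r (ltW bb0) w_lb2.
  have -> : w * (beta ^+ 2 + beta + 1) * (beta + 1) =
    w * (beta + 1) * (beta ^+ 2 + beta + 1) by ring.
  move=> h1 h2; have := le_trans h1 h2.
  have -> : (beta + 1) * (beta + 1) = beta ^+ 2 + beta + beta + 1 by ring.
  have -> : beta * (beta ^+ 2 + beta + 1) = beta ^+ 3 + beta ^+ 2 + beta by ring.
  lra.
apply/eqP; rewrite eq_le b3ge andbT leNgt; apply/negP => b3gt.
have b32 : beta < 3 / 2.
  have : 0 < (3 / 2 - beta) * (3 / 2 + beta).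
    have -> : (3 / 2 - beta) * (3 / 2 + beta) = 9 / 4 - beta ^+ 2 by field.
    lra.
  by rewrite pmulr_lgt0 ?subr_gt0 //; lra.
have b3lt : beta ^+ 3 < beta ^+ 2 + 1.
  have -> : beta ^+ 3 = beta ^+ 2 * (beta - 1) + beta ^+ 2 by ring.
  have := ler_wpM2r (ltW b1) b2le; lra.
have ltab3 : a < b + 3%N%:Z.
  rewrite -(ltr_eXz2l beta_gt1) zE -ha -hb.
  have h1 : 0 <= (beta - 1) * (beta ^+ 2 + 1) * (beta - w * (beta + 1)).
    by rewrite mulr_ge0 ?subr_ge0 // mulr_ge0 ?ltW //; lra.
  have h2 : 0 < (beta - 1) * (beta ^+ 2 + 1 - beta ^+ 3).
    by rewrite mulr_gt0 ?subr_gt0.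
  rewrite -subr_gt0.
  have -> : (1 - beta * w) * beta ^+ 3 - (1 - w) =
     (beta - 1) * (beta ^+ 2 + 1) * (beta - w * (beta + 1)) +
     (beta - 1) * (beta ^+ 2 + 1 - beta ^+ 3) by ring.
  lra.
have aE : a = b + 2%N%:Z by clear -ltab3 leb2a; lia.
have wE : w * (beta ^+ 2 + beta + 1) = beta + 1.
  have := ha; rewrite aE zE -hb => e1.
  apply: (mulfI (lt0r_neq0 b1)).
  have -> : (beta - 1) * (w * (beta ^+ 2 + beta + 1)) =
    (beta - 1) * (beta + 1) + ((1 - beta * w) * beta ^+ 2 *-1 + (1 - w)) by ring.
  by rewrite -e1; ring.
(* Now beta^-b = beta^2 + beta + 1, and this lies strictly between beta^4 and beta^5 when beta + 1 <
   beta^3 < beta^2 + 1. *)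
have DE : (beta ^+ 2 + beta + 1) * beta ^ b = 1.
  rewrite -hb.
  have -> : (beta ^+ 2 + beta + 1) * (1 - beta * w) =
    beta ^+ 2 + beta + 1 - beta * (w * (beta ^+ 2 + beta + 1)) by ring.
  by rewrite wE; ring.
have bb := expz_gt0 beta_gt1 b.
have b4 : b + 4%N%:Z < 0.
  rewrite -(ltr_eXz2l beta_gt1) zE expr0z -DE mulrC ltr_pM2r //.
  have : 0 < (beta + 1) * (beta ^+ 2 + 1 - beta ^+ 3).
    by rewrite mulr_gt0 ?subr_gt0 //; lra.
  have -> : (beta + 1) * (beta ^+ 2 + 1 - beta ^+ 3) =
     beta ^+ 2 + beta + 1 - beta ^+ 4 by ring.
  lra.
have b5 : 0 < b + 5%N%:Z.
  rewrite -(ltr_eXz2l beta_gt1) zE expr0z -DE mulrC ltr_pM2l //.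
  have : 0 < (beta ^+ 2 + 1) * (beta ^+ 3 - (beta + 1)).
    by rewrite mulr_gt0 ?subr_gt0 //; lra.
  have -> : (beta ^+ 2 + 1) * (beta ^+ 3 - (beta + 1)) =
     beta ^+ 5 - (beta ^+ 2 + beta + 1) by ring.
  lra.
by clear -b4 b5; lia.
Qed.

Lemma reducible_bases :
  (exists t1 ps, unity_data beta t1 ps /\ ps != [::]) \/ beta ^+ 3 = beta + 1.
Proof.
have [le2|gt2] := leP (beta ^+ 2) 2.
  by right; apply: reducible_small_base.
left; apply: reducible_unity_data.
have /andP[t_le _] := truncn_itv (ltW b0).
have [lt2|ge2] := ltP beta 2.
  suff -> : Num.truncn beta = 1%N by [].
  by apply: truncn_def; rewrite lt2 (ltW beta_gt1).
rewrite -natr1.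
have := ler_wpM2r (ltW b0) ge2; rewrite -expr2; lra.
Qed.

End GreedyReducibleBases.

(** * The beta-transformation *)

Section BetaTransformation.
Variables (R : realType) (beta : R).
Hypothesis beta_gt1 : 1 < beta.
Let b0 : 0 < beta := beta_gt0 beta_gt1.
Let bn0 : beta != 0 := beta_neq0 beta_gt1.

Definition first_digit (y : R) : nat := Num.truncn (beta * y).

Definition beta_shift (y : R) : R := beta * y - (first_digit y)%:R.

Lemma beta_shift_bounds y : 0 <= y -> 0 <= beta_shift y < 1.
Proof.
move=> y0; have /andP[h1 h2] := truncn_itv (mulr_ge0 (ltW b0) y0).
by rewrite /beta_shift subr_ge0 h1 /= ltrBlDl natr1.
Qed.

Lemma iter_shift_bounds y n : 0 <= y < 1 -> 0 <= iter n beta_shift y < 1.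
Proof.
move=> hy; elim: n => //= n /andP[h _]; exact: beta_shift_bounds.
Qed.

Lemma first_digit_eq y k : k%:R <= beta * y < k%:R + 1 -> first_digit y = k.
Proof. by rewrite natr1; apply: truncn_def. Qed.

Lemma shift_expansion y n :
  y = \sum_(i < n) (first_digit (iter i beta_shift y))%:R * beta ^- i.+1
      + beta ^- n * iter n beta_shift y.
Proof.
elim: n => [|n IH]; first by rewrite big_ord0 add0r expr0 invr1 mul1r.
rewrite {1}IH big_ord_recr /= -addrA; congr (_ + _).
rewrite {3}/beta_shift; set z := iter n _ _.
by rewrite exprS; field; rewrite bn0 expf_neq0.
Qed.

Lemma iter_shift_small y n : 0 <= y -> beta ^+ n * y < 1 ->
  iter n beta_shift y = beta ^+ n * y /\
  forall i, (i < n)%N -> first_digit (iter i beta_shift y) = 0%N.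
Proof.
move=> y0; elim: n => [|n IH] h; first by rewrite mul1r.
have [|e1 e2] := IH.
  apply: le_lt_trans h; rewrite exprS -mulrA ler_peMl ?mulr_ge0 ?exprn_ge0 //;
  exact: ltW.
have d0 : first_digit (iter n beta_shift y) = 0%N.
  apply: first_digit_eq; rewrite e1 mulrA -exprS add0r h andbT.
  by rewrite mulr_ge0 ?exprn_ge0 // ltW.
split=> [|i]; first by rewrite /= {1}/beta_shift d0 subr0 e1 mulrA -exprS.
by rewrite ltnS leq_eqVlt => /orP[/eqP ->|/e2].
Qed.

(** Without a carry the perturbation [y] is merely multiplied by beta at each step and never reaches
    the digits. *)
Lemma iter_shift_add x y n : 0 <= x -> 0 <= y ->
  (forall j, (0 < j <= n)%N -> iter j beta_shift x + beta ^+ j * y < 1) ->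
  iter n beta_shift (x + y) = iter n beta_shift x + beta ^+ n * y /\
  forall i, (i < n)%N ->
    first_digit (iter i beta_shift (x + y)) = first_digit (iter i beta_shift x).
Proof.
move=> x0 y0; elim: n => [|n IH] h; first by rewrite mul1r.
have [|e1 e2] := IH.
  by move=> j /andP[j0 jn]; apply: h; rewrite j0 ltnW.
have xn0 : 0 <= iter n beta_shift x.
  case: (n) => //= k; suff : 0 <= iter k beta_shift x.
    by case/beta_shift_bounds/andP.
  elim: k => //= k; by case/beta_shift_bounds/andP.
have dd : first_digit (iter n beta_shift (x + y)) =
          first_digit (iter n beta_shift x).
  apply: first_digit_eq; rewrite e1.
  have := h n.+1; rewrite ltnS leqnn => /(_ isT) /=.
  rewrite {1}/beta_shift exprS.
  have /andP[+ _] := beta_shift_bounds xn0; rewrite {1}/beta_shift.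
  have : 0 <= beta * beta ^+ n * y.
    by rewrite !mulr_ge0 ?exprn_ge0 // ltW.
  set q := iter n _ _; move=> *; apply/andP; split; lra.
split=> [|i]; last by rewrite ltnS leq_eqVlt => /orP[/eqP ->|/e2].
move: dd; rewrite /= e1; set z := iter n beta_shift x => dd.
by rewrite /beta_shift dd exprS; ring.
Qed.

(* The limit t is the orbit of 1 under the left-continuous version of the
   beta-transformation, which avoids 0. *)
Lemma iter_shift_near_one m : exists t, 0 < t <= 1 /\
  exists2 z, 0 < z & forall s, 0 < s < z ->
    iter m beta_shift (1 - s) = t - beta ^+ m * s.
Proof.
elim: m => [|m [t [/andP[t0 t1] [z z0 hz]]]].
  by exists 1; rewrite ltr01 lexx; split=> //; exists 1 => // s _; rewrite mul1r.
have bt0 : 0 < beta * t by rewrite mulr_gt0.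
have [k /andP[k1 k2]] : exists k : nat, k%:R < beta * t <= k%:R + 1.
  have /andP[h1 h2] := truncn_itv (ltW bt0).
  case e : (Num.truncn (beta * t)) h1 h2 => [|k] h1 h2.
    by exists 0%N; rewrite bt0 add0r ltW.
  move: h1; rewrite le_eqVlt => /orP[/eqP h1|h1].
    by exists k; rewrite -h1 ltr_nat ltnSn natr1 lexx.
  by exists k.+1; rewrite h1 natr1 ltW.
exists (beta * t - k%:R); split; first by rewrite subr_gt0 k1 lerBlDl.
have bm0 : 0 < beta ^+ m.+1 by rewrite exprn_gt0.
exists (Order.min z ((beta * t - k%:R) / beta ^+ m.+1)).
  by rewrite lt_min z0 divr_gt0 // subr_gt0.
move=> s /andP[s0]; rewrite lt_min => /andP[sz]; rewrite ltr_pdivlMr // => hs.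
rewrite /= hz ?s0 // /beta_shift (@first_digit_eq _ k) ?exprS; first by ring.
rewrite exprS in hs.
have : 0 < beta * beta ^+ m * s by rewrite -exprS mulr_gt0.
move=> *; apply/andP; split; lra.
Qed.

(** Just below 1 the iterate is t - beta^m s with t <= 1. If t = 1, then beta^m s > s > e suffices;
    if t < 1, it is enough that e < 1 - t. Only finitely many m occur, so one [e0] serves them
    all. *)
Lemma iter_shift_off_one m0 (L : R) : exists2 e0, 0 < e0 &
  forall e m s, 0 < e < e0 -> (0 < m <= m0)%N -> e < s < L * e ->
    iter m beta_shift (1 - s) < 1 - e.
Proof.
elim: m0 => [|m0 [e0 e00 IH]]; first by exists 1 => // e [|].
have [t [/andP[t0 t1] [z z0 hz]]] := iter_shift_near_one m0.+1.
have L1 : 0 < `|L| + 1 by rewrite ltr_wpDl.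
pose w := if t < 1 then 1 - t else 1.
have w0 : 0 < w by rewrite /w; case: ifP => //; rewrite subr_gt0.
exists (Order.min e0 (Order.min w (z / (`|L| + 1)))).
  by rewrite !lt_min e00 w0 divr_gt0.
move=> e m s; rewrite !lt_min => /andP[ep /and3P[ee0 ew]].
rewrite ltr_pdivlMr // => ez /andP[m0p].
rewrite leq_eqVlt ltnS => /orP[/eqP ->|mm0] hs; last first.
  by apply: IH; rewrite ?ep ?m0p.
have /andP[es sL] := hs.
have sz : s < z.
  apply: lt_trans sL (le_lt_trans _ ez).
  rewrite mulrC ler_pM2l //; apply: le_trans (ler_norm _) _; lra.
rewrite hz ?sz ?(lt_trans ep) //.
have bs : s < beta ^+ m0.+1 * s.
  by rewrite ltr_pMl ?exprn_egt1 // (lt_trans ep).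
move: ew; rewrite /w; case: ltP => ht ew; lra.
Qed.

Fixpoint digit_list (n : nat) (q : int) (y : R) : seq int :=
  if n is n'.+1 then
    nseq (first_digit y) (q - 1) ++ digit_list n' (q - 1) (beta_shift y)
  else [::].

Lemma digit_listP n q y : 0 <= y < 1 -> iter n beta_shift y = 0 ->
  [/\ greedy beta (digit_list n q y),
      power_sum beta (digit_list n q y) = beta ^ q * y
    & size (digit_list n q y) =
      (\sum_(i < n) first_digit (iter i beta_shift y))%N].
Proof.
elim: n q y => [|n IH] q y /andP[y0 y1]; rewrite ?iterSr /= => h.
  split; [exact: greedy_nil | by rewrite h mulr0 /power_sum big_nil |].
  by rewrite big_ord0.
have [g v sz] := IH (q - 1) _ (beta_shift_bounds y0) h.
have vE : power_sum beta (digit_list n.+1 q y) = beta ^ q * y.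
  rewrite /= power_sum_cat v /power_sum big_nseq iter_addr_0 -mulr_natl.
  have -> : beta ^ q = beta ^ (q - 1) * beta.
    by rewrite -[in RHS](expr1z beta) -expzD // subrK.
  by rewrite /beta_shift; ring.
split=> // [k|]; last first.
  by rewrite size_cat size_nseq sz big_ord_recl; congr (_ + _)%N;
     apply: eq_bigr => i _; rewrite /bump /= -iterSr.
have [kq|qk] := ltP k q; last first.
  apply: (@lt_le_trans _ _ (beta ^ q)); last by rewrite ler_eXz2l.
  apply: (@le_lt_trans _ _ (power_sum beta (digit_list n.+1 q y))).
    rewrite /power_sum [leRHS](bigID (fun e => e < k)) /= lerDl.
    by apply: sumr_ge0 => e _; rewrite ltW ?expz_gt0.
  by rewrite vE gtr_pMr ?expz_gt0.
rewrite /= big_cat /= big_nseq_cond ifF ?add0r; first exact: g.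
by lia.
Qed.

(** Multiplying a fixed irreducible sum by beta^-M only prepends zero digits, so neither the number
    [N] of powers nor the margin between [th] and 1 depends on [zeta]. This allows the parameters of
    the strategy to be fixed before the configuration is scaled down. *)
Lemma not_reducible_chips : ~ greedy_reducible beta ->
  exists N (th : R), th < 1 /\ forall zeta, 0 < zeta ->
  exists xs n, let eta := \sum_(o <- xs) beta ^- o in
    [/\ size xs = N, (forall o, o \in xs -> (0 < o)%N), 0 < eta < zeta,
        (0 < n)%N &
        [/\ forall j, (j <= n)%N -> iter j beta_shift eta <= th,
            (N < \sum_(i < n) first_digit (iter i beta_shift eta))%N &
            (0 < first_digit (iter n.-1 beta_shift eta))%N]].
Proof.
move=> nred.
have [s hs] : exists s, forall s', greedy beta s' ->
    power_sum beta s' = power_sum beta s -> (size s < size s')%N.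
  apply: contrapT => hno; apply: nred => s; apply: contrapT => hno'.
  apply: hno; exists s => s' g v; rewrite ltnNge; apply/negP => sz.
  by apply: hno'; exists s'.
have [q qs qv] : exists2 q : nat, forall e, e \in s -> e < q%:Z
                 & power_sum beta s < beta ^ q.
  have [n1 hn1] := expr_unbounded beta_gt1 (power_sum beta s).
  exists n1 => // e /(mem_power_sum beta_gt1) he.
  by rewrite -(ltr_eXz2l beta_gt1); apply: le_lt_trans hn1.
pose x := beta ^ (- q%:Z) * power_sum beta s.
have x01 : 0 <= x < 1.
  rewrite mulr_ge0 ?power_sum_ge0 ?(ltW (expz_gt0 _ _)) //=.
  rewrite -(ltr_pM2l (expz_gt0 beta_gt1 q)) mulrA -expzD // subrr expr0z mul1r.
  by rewrite mulr1.
have vx : beta ^ q * x = power_sum beta s.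
  by rewrite mulrA -expzD // subrr expr0z mul1r.
pose D i := first_digit (iter i beta_shift x).
(* Otherwise the digits vanish from some place on; the orbit must have reached 0 there, as it would
   else grow by the factor beta forever, and the digits form a greedy list no longer than [s]. *)
have [n0 hn0] : exists n, (size s < \sum_(i < n) D i)%N.
  apply: contrapT => hno.
  have bd n : (\sum_(i < n) D i <= size s)%N.
    by rewrite leqNgt; apply/negP => h; apply: hno; exists n.
  have [n1 hn1] : exists n1, forall m, (\sum_(i < m) D i <= \sum_(i < n1) D i)%N.
    pose P v := `[< exists n, (\sum_(i < n) D i)%N = v >].
    have exP : exists v, P v by exists (\sum_(i < 0) D i)%N; apply/asboolP; exists 0%N.
    have [|v /asboolP[n1 e1] hv] := @ex_maxnP P (size s) exP.
      by move=> v /asboolP[n <-].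
    exists n1 => m; rewrite e1; apply: hv; apply/asboolP; by exists m.
  have D0 i : (n1 <= i)%N -> D i = 0%N.
    move=> le; have := hn1 i.+1; rewrite big_ord_recr /=.
    have : (\sum_(i < n1) D i <= \sum_(j < i) D j)%N.
      rewrite -!(big_mkord xpredT D) [leqRHS](@big_cat_nat _ _ _ n1) //=.
      exact: leq_addr.
    move=> h1 h2; have := leq_trans h2 h1.
    by rewrite -[X in (_ <= X)%N]addn0 leq_add2l leqn0 => /eqP.
  have T0 : iter n1 beta_shift x = 0.
    have /andP[t0 _] := iter_shift_bounds n1 x01.
    apply/eqP; rewrite eq_le t0 andbT leNgt; apply/negP => tp.
    have grow m : iter (n1 + m) beta_shift x = beta ^+ m * iter n1 beta_shift x.
      elim: m => [|m IH]; first by rewrite addn0 mul1r.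
      have := D0 (n1 + m)%N (leq_addr _ _); rewrite /D => dz.
      by rewrite addnS /= {1}/beta_shift dz subr0 IH mulrA -exprS.
    have [m hm] := expr_unbounded beta_gt1 (iter n1 beta_shift x)^-1.
    have /andP[_] := iter_shift_bounds (n1 + m) x01.
    by rewrite grow ltNge -ler_pdivrMr // mul1r ltW.
  have [g v sz] := digit_listP q%:Z x01 T0.
  have := hs _ g; rewrite v vx => /(_ erefl); rewrite sz.
  by rewrite ltnNge bd.
have exn : exists n, (size s < \sum_(i < n) D i)%N by exists n0.
(* Minimality of [n] makes the digit at index n - 1 nonzero, which later keeps the orbit from
   becoming negligible before step [n]. *)
case: (ex_minnP exn) => n hn nmin {n0 hn0 exn}.
have n0 : (0 < n)%N by case: (n) hn => //; rewrite big_ord0.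
have Dn : (0 < D n.-1)%N.
  rewrite lt0n; apply/eqP => D0; have : (n <= n.-1)%N.
    apply: nmin; by move: hn D0; case: (n) n0 => // k _; rewrite big_ord_recr /= => h D0; move: h; rewrite D0 addn0.
  by lia.
have [th th1 hth] : exists2 th, th < 1 &
    forall j, (j <= n)%N -> iter j beta_shift x <= th.
  elim: (n) => [|k [th th1 IH]].
    have /andP[_ x1] := x01; exists x => // j; by rewrite leqn0 => /eqP ->.
  have /andP[_ t1] := iter_shift_bounds k.+1 x01.
  exists (Order.max th (iter k.+1 beta_shift x)); first by rewrite gt_max th1.
  move=> j; rewrite leq_eqVlt ltnS => /orP[/eqP ->|/IH h].
    by rewrite le_max lexx orbT.
  by rewrite le_max h.
exists (size s), th; split=> // zeta zeta0.
have [M hM] := expr_unbounded beta_gt1 (x / zeta).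
have bM0 : 0 < beta ^+ M by rewrite exprn_gt0.
pose eta := beta ^- M * x.
exists [seq `|(q%:Z + M%:Z - e)%R|%N | e <- s], (M + n)%N => /=.
have etaE : \sum_(o <- [seq `|(q%:Z + M%:Z - e)%R|%N | e <- s]) beta ^- o = eta.
  rewrite big_map /eta /x /power_sum !mulr_sumr big_seq [RHS]big_seq.
  apply: eq_bigr => e /qs he; have -> : beta ^- M = beta ^ (- M%:Z) by rewrite -invr_expz.
  rewrite -!expzD //; set k := `|_|%N; have -> : beta ^- k = beta ^ (- k%:Z)
    by rewrite -invr_expz.
  by congr (_ ^ _); rewrite /k; clear -he; lia.
rewrite etaE.
have /andP[x0 x1] := x01.
have eta0 : 0 <= eta by rewrite mulr_ge0 // invr_ge0 ltW.
have etaM : beta ^+ M * eta = x by rewrite /eta mulrA divff ?mul1r // gt_eqF.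
have small j : (j <= M)%N -> beta ^+ j * eta <= x.
  move=> jM; rewrite -etaM ler_wpM2r // ler_weXn2l //; exact: ltW.
have [e1 e2] : iter M beta_shift eta = x /\
    forall i, (i < M)%N -> first_digit (iter i beta_shift eta) = 0%N.
  by have := @iter_shift_small eta M eta0; rewrite etaM; apply.
have e3 i : iter (M + i) beta_shift eta = iter i beta_shift x.
  by rewrite addnC iterD e1.
have xp : 0 < x.
  rewrite lt_def x0 andbT; apply/eqP => xz.
  have it0 i : iter i beta_shift x = 0.
    elim: i => [|i IH]; rewrite //= IH /beta_shift (@first_digit_eq _ 0%N).
      by rewrite mulr0 subr0.
    by rewrite mulr0 lexx add0r ltr01.
  by move: Dn; rewrite /D it0 /first_digit mulr0 truncn0.
split; [by rewrite size_map | | | by rewrite addn_gt0 n0 orbT |].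
- by move=> o /mapP[e /qs he ->]; clear -he; lia.
- rewrite mulr_gt0 ?invr_gt0 //= -(ltr_pM2l bM0) etaM mulrC -ltr_pdivrMl //.
  by rewrite mulrC.
split.
- move=> j jn; have [jM|Mj] := leqP j M.
    have bj : beta ^+ j * eta < 1 by apply: le_lt_trans x1; apply: small.
    have [-> _] := iter_shift_small eta0 bj.
    by apply: le_trans (small _ jM) _; apply: (hth 0%N).
  by rewrite -(subnKC (ltnW Mj)) e3; apply: hth; rewrite leq_subLR.
- rewrite big_split_ord /= big1 ?add0n; last by move=> i _; rewrite e2.
  by rewrite (eq_bigr (fun i : 'I_n => D i)) // => i _; rewrite e3.
- by rewrite -{1}(prednK n0) addnS /= e3.
Qed.

End BetaTransformation.

(** * A strategy that beats the greedy expansion *)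

Lemma bump_arith (R : realType) (b k s : R) :
  s * b <= k * (b - 1) -> k <= b * (k - s).
Proof. lra. Qed.

Section Process.
Variables (R : realType) (beta : R).
Hypothesis beta_gt1 : 1 < beta.
Variables (xs : seq nat) (n m0 : nat) (th eps delta q : R).
Let T := beta_shift beta.
Let eta := \sum_(o <- xs) beta ^- o.
Hypotheses (xs_pos : forall o, o \in xs -> (0 < o)%N) (eta_gt0 : 0 < eta)
  (n_gt0 : (0 < n)%N)
  (orbit_le : forall j, (j <= n)%N -> iter j T eta <= th)
  (many_digits : (size xs < \sum_(i < n) first_digit beta (iter i T eta))%N)
  (last_digit : (0 < first_digit beta (iter n.-1 T eta))%N).
(** States are kept below 1 - eps. The equation for [q] makes every bump smaller than q / beta;
    [delta] is the threshold under which a state counts as negligible, and [m0] steps shrink 5 q to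
    at most eps / 2. *)
Hypotheses (eps_gt0 : 0 < eps) (qE : q * (beta - 1) = eps * beta ^+ 2)
  (q_le : q <= 1 / 8) (th_eps : th + 2 * eps <= 1)
  (m0_large : 10 * q <= eps * beta ^+ m0)
  (off_one : forall m s, (0 < m <= m0)%N -> eps < s < 6 * q ->
     iter m T (1 - s) < 1 - eps)
  (eta_small : 8 * (eta * beta) <= eps * (beta - 1))
  (delta_gt0 : 0 < delta) (delta_eps : 4 * delta <= eps)
  (delta_n : beta ^+ n * delta < eps).

Let b0 : 0 < beta := beta_gt0 beta_gt1.
Let bn0 : beta != 0 := beta_neq0 beta_gt1.
Let b1 : 0 < beta - 1. Proof. by rewrite subr_gt0. Qed.

Lemma eps_lt_q : eps < q.
Proof.
rewrite -(ltr_pM2r b1) qE ltr_pM2l //.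
have : 0 < beta ^+ 2 - beta by rewrite subr_gt0 expr2 ltr_pMl.
by lra.
Qed.

Lemma q_lt1 : q < 1.
Proof. by rewrite (le_lt_trans q_le) // ltr_pdivrMr // mul1r ltr1n. Qed.

Lemma eps_lt8 : eps < 1 / 8.
Proof. exact: lt_le_trans eps_lt_q q_le. Qed.

(* With kap = beta^-m the two inequalities place kap - s in the interval
   [kap / beta, kap * (1 - eps)), so that the next nonzero digit arrives before
   the remainder can come within eps of 1 again. *)
Definition bump_offset_spec (s : R) (m : nat) : Prop :=
  s * beta <= beta ^- m * (beta - 1) /\ beta ^- m * (beta - 1) < s * beta ^+ 2.

Definition bump_offset (s : R) : nat := xget 0%N [set m | bump_offset_spec s m].

(** The least m with the second inequality works: the first one is the failure of the second at m -
    1, and for m = 0 it follows from s <= eps and q <= 1. *)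
Lemma bump_offsetP s : 0 < s <= eps -> bump_offset_spec s (bump_offset s).
Proof.
move=> /andP[s0 seps].
suff [m hm] : exists m, bump_offset_spec s m.
  by have /= := @xgetPex _ 0%N [set m | bump_offset_spec s m] (ex_intro _ m hm).
pose P m := beta ^- m * (beta - 1) < s * beta ^+ 2.
have exP : exists m, P m.
  have sb0 : 0 < s * beta ^+ 2 by rewrite mulr_gt0 ?exprn_gt0.
  have [m hm] := expr_unbounded beta_gt1 ((beta - 1) / (s * beta ^+ 2)).
  exists m; rewrite /P mulrC ltr_pdivrMr ?exprn_gt0 //.
  by rewrite mulrC -ltr_pdivrMr.
case: (ex_minnP exP) => m Pm mmin; exists m; split=> //.
case: m Pm mmin => [|m] Pm mmin.
  rewrite expr0 invr1 mul1r; have := q_le; have := qE.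
  have : s * beta <= eps * beta ^+ 2.
    rewrite expr2 mulrA ler_wpM2r ?(ltW b0) //; apply: le_trans seps _.
    by rewrite ler_peMr ?ltW.
  move=> h1 h2 h3; apply: le_trans h1 _; rewrite -h2 ger_pMl //; lra.
rewrite leNgt; apply/negP => h.
suff : P m by move=> /mmin; rewrite ltnn.
rewrite /P (_ : beta ^- m = beta ^- m.+1 * beta); last first.
  by rewrite exprS invfM mulrAC mulVf ?mul1r.
by rewrite mulrAC expr2 mulrA ltr_pM2r.
Qed.

(* The strategy: y is what remains to be emitted of the chips already placed.
   When y is negligible, place the configuration xs, whose greedy digits
   outnumber its chips.  When the next remainder is 1 - s with s <= eps, place
   one chip that pushes it past 1: later chips could otherwise overflow into
   digits already emitted.  In all other cases just emit the next digit. *)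
Definition chips (y : R) : seq nat :=
  if y < delta then xs
  else if 1 - eps <= T y then [:: (bump_offset (1 - T y)).+1] else [::].

Definition added (y : R) : R := \sum_(o <- chips y) beta ^- o.
Definition next_state (y : R) : R := T (y + added y).
Definition emitted (y : R) : nat := first_digit beta (y + added y).

Definition valid (y : R) : Prop := 0 <= y < 1 - eps.

Lemma next_low y : valid y -> y < delta ->
  [/\ chips y = xs, added y = eta & next_state y <= beta * (y + eta)].
Proof.
move=> /andP[y0 y1] yd; have cE : chips y = xs by rewrite /chips yd.
have aE : added y = eta by rewrite /added cE.
split=> //; rewrite /next_state aE /T /beta_shift lerBlDr lerDl ler0n //.
Qed.

(** The chip raises the next remainder from 1 - s to 1 + kap - s: one chip is matched by one extra
    digit, so a bump by itself is neutral. *)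
Lemma next_bump y : valid y -> delta <= y -> 1 - eps <= T y ->
  exists m, let kap := beta ^- m in
  [/\ chips y = [:: m.+1], added y * beta = kap,
      next_state y = kap - (1 - T y), emitted y = (first_digit beta y).+1 &
      [/\ kap <= beta * next_state y, next_state y < kap * (1 - eps) & kap < q]].
Proof.
move=> /andP[y0 y1] dy Ty.
have /andP[T0 T1] := beta_shift_bounds beta_gt1 y0; rewrite -/T in T0 T1.
pose s := 1 - T y; have s0 : 0 < s by rewrite subr_gt0.
have seps : s <= eps by rewrite /s; lra.
have [h1 h2] : bump_offset_spec s (bump_offset s) by apply: bump_offsetP; rewrite s0.
exists (bump_offset s); set m := bump_offset s; rewrite /= -/m in h1 h2 *.
have k0 : 0 < beta ^- m by exact: expVn_gt0.
have cE : chips y = [:: m.+1] by rewrite /chips ltNge dy /= Ty.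
have aE : added y * beta = beta ^- m.
  by rewrite /added cE big_seq1 exprS invfM mulrAC mulVf ?mul1r.
have kq : beta ^- m < q.
  rewrite -(ltr_pM2r b1); apply: lt_le_trans h2 _.
  by rewrite qE ler_wpM2r ?exprn_ge0 ?(ltW b0).
have sk : s <= beta ^- m.
  rewrite -(ler_pM2r b0); apply: le_trans h1 _.
  by rewrite ler_pM2l // gerBl ler01.
have bE : beta * (y + added y) = (first_digit beta y)%:R + 1 + (beta ^- m - s).
  rewrite mulrDr [beta * added y]mulrC aE /s /T /beta_shift; ring.
have dE : emitted y = (first_digit beta y).+1.
  apply: first_digit_eq; rewrite bE -natr1 lerDl subr_ge0 sk ltrD2l ltrBlDr.
  by apply: (lt_trans kq); apply: (lt_trans q_lt1); rewrite ltrDl.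
have nE : next_state y = beta ^- m - s.
  by rewrite /next_state /T /beta_shift -/(emitted y) dE bE -natr1; ring.
split=> //; rewrite nE; split=> //.
  exact: bump_arith h1.
rewrite mulrBr mulr1 ltrD2l ltrN2.
have e8 : eps * beta ^+ 2 <= beta - 1.
  by rewrite -qE ger_pMl // ltW // q_lt1.
have bb : 0 < beta ^+ 2 by rewrite exprn_gt0.
rewrite -(ltr_pM2r bb); apply: le_lt_trans h2.
by rewrite -mulrA ler_pM2l.
Qed.

Lemma next_plain y : valid y -> delta <= y -> T y < 1 - eps ->
  [/\ chips y = [::], added y = 0, next_state y = T y
    & emitted y = first_digit beta y].
Proof.
move=> vy dy Ty; have cE : chips y = [::].
  by rewrite /chips ltNge dy /= leNgt Ty.
have aE : added y = 0 by rewrite /added cE big_nil.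
by rewrite /next_state /emitted aE addr0.
Qed.

Lemma iter_low y i : valid y -> y < delta -> (i <= n)%N ->
  iter i T (y + eta) = iter i T eta + beta ^+ i * y /\
  forall j, (j < i)%N ->
    first_digit beta (iter j T (y + eta)) = first_digit beta (iter j T eta).
Proof.
move=> /andP[y0 y1] yd hi; rewrite addrC.
apply: iter_shift_add => //; first exact: ltW.
move=> j /andP[_ ji]; have jn := leq_trans ji hi.
have : beta ^+ j * y <= beta ^+ n * delta.
  by rewrite ler_pM ?exprn_ge0 ?(ltW b0) ?(ltW yd) // ler_weXn2l // ltW.
have := orbit_le jn; have := th_eps; have := delta_n; rewrite /T.
by move: eps_gt0; lra.
Qed.

Lemma low_orbit_lt y i : valid y -> y < delta -> (i <= n)%N ->
  iter i T (y + eta) < 1 - eps.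
Proof.
move=> vy yd hi; have [-> _] := iter_low vy yd hi.
have /andP[y0 y1] := vy.
have : beta ^+ i * y <= beta ^+ n * delta.
  by rewrite ler_pM ?exprn_ge0 ?(ltW b0) ?(ltW yd) // ler_weXn2l // ltW.
have := orbit_le hi; have := th_eps; have := delta_n; lra.
Qed.

Lemma valid_next y : valid y -> valid (next_state y).
Proof.
move=> vy; have /andP[y0 y1] := vy.
have [yd|dy] := ltP y delta.
  have [_ aE _] := next_low vy yd.
  rewrite /valid /next_state aE.
  have /andP[-> _] : 0 <= T (y + eta) < 1.
    by apply: beta_shift_bounds => //; rewrite addr_ge0 // ltW.
  by rewrite (low_orbit_lt vy yd (i := 1%N)).
have [Ty|Ty] := leP (1 - eps) (T y); last first.
  have [_ _ nE _] := next_plain vy dy Ty.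
  rewrite /valid nE Ty andbT.
  by have /andP[] := beta_shift_bounds beta_gt1 y0.
have [m [_ _ nE _ [h1 h2 h3]]] := next_bump vy dy Ty.
have k0 : 0 < beta ^- m by exact: expVn_gt0.
apply/andP; split.
  by rewrite -(pmulr_rge0 _ b0); apply: le_trans h1; exact: ltW.
apply: lt_le_trans h2 _; rewrite ger_pMl.
  have := q_le; lra.
have := eps_lt8; lra.
Qed.

Lemma valid_iter y k : valid y -> valid (iter k next_state y).
Proof. by move=> vy; elim: k => //= k; apply: valid_next. Qed.

(** * Conservation of value and bounds on future chips *)

Definition addition (y : R) (k : nat) : R :=
  \sum_(j < k) beta ^- j * added (iter j next_state y).
Definition emission (y : R) (k : nat) : R :=
  \sum_(j < k) (emitted (iter j next_state y))%:R * beta ^- j.+1.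
Definition digit_count (y : R) (k : nat) : nat :=
  \sum_(j < k) emitted (iter j next_state y).
Definition chip_count (y : R) (k : nat) : nat :=
  \sum_(j < k) size (chips (iter j next_state y)).

Lemma added_ge0 y : 0 <= added y.
Proof. by apply: sumr_ge0 => o _; rewrite invr_ge0 exprn_ge0 // ltW. Qed.

Lemma additionS y k : addition y k.+1 =
  added y + beta^-1 * addition (next_state y) k.
Proof.
rewrite /addition big_ord_recl expr0 invr1 mul1r mulr_sumr; congr (_ + _).
apply: eq_bigr => i _; rewrite /= -iterSr mulrA; congr (_ * _).
by rewrite exprS invfM.
Qed.

Lemma addition_cat y j k : addition y (j + k) =
  addition y j + beta ^- j * addition (iter j next_state y) k.
Proof.
rewrite /addition big_split_ord mulr_sumr; congr (_ + _).
apply: eq_bigr => i _ /=; rewrite mulrA addnC iterD; congr (_ * _).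
by rewrite exprD invfM mulrC.
Qed.

Lemma addition_ge0 y k : 0 <= addition y k.
Proof.
by apply: sumr_ge0 => i _; rewrite mulr_ge0 ?added_ge0 // invr_ge0 exprn_ge0 // ltW.
Qed.

Lemma conservation y k : y + addition y k =
  emission y k + beta ^- k * iter k next_state y.
Proof.
elim: k => [|k IH]; first by rewrite /addition /emission !big_ord0 expr0 invr1 /=; ring.
rewrite /addition /emission !big_ord_recr /= addrA [y + _]IH -/(emission y k) -!addrA.
congr (_ + _); set z := iter k _ _.
rewrite /next_state /T /beta_shift -/(emitted z) exprS.
by field; rewrite bn0 expf_neq0.
Qed.

Let mu := 2 * (eta * beta) / (beta - 1).

Lemma mu_le : 0 < mu /\ 4 * mu <= eps.
Proof.
split; first by rewrite /mu divr_gt0 // mulr_gt0 // mulr_gt0.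
rewrite /mu mulrA ler_pdivrMr //; apply: le_trans eta_small.
by rewrite mulrA -natrM.
Qed.

(** The bound is a potential: added y + beta^-1 (4 q y' + mu) <= 4 q y + mu for the next state y'. A
    bump adds kap / beta with kap < q and occurs only when beta y >= 1/2. Placing [xs] adds eta;
    [mu] is the geometric accumulation of such additions, doubled to absorb the term 4 q eta. *)
Lemma addition_le y k : valid y -> addition y k <= 4 * q * y + mu.
Proof.
have [mu0 mu4] := mu_le; have q8 := q_le.
have q0 : 0 < q := lt_trans eps_gt0 eps_lt_q.
elim: k y => [|k IH] y vy; have /andP[y0 y1] := vy.
  rewrite /addition big_ord0 addr_ge0 ?(ltW mu0) // mulr_ge0 // mulr_ge0 //.
  exact: ltW.
rewrite additionS; have := IH _ (valid_next vy) => {}IH.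
have {}IH := ler_wpM2l (ltW b0) (lerD (lexx (added y)) (ler_wpM2l (ltW (expVn_gt0 beta_gt1 1)) IH)).
rewrite -(ler_pM2l b0); apply: le_trans IH _.
rewrite mulrDr expr1 mulrA divff // mul1r.
have mub : mu <= beta * mu by rewrite ler_peMl ?ltW.
have [yd|dy] := ltP y delta.
  have [_ -> h] := next_low vy yd.
  have q40 : 0 <= 4 * q by lra.
  have := ler_wpM2l q40 h.
  have be0 : 0 < eta * beta by rewrite mulr_gt0.
  have q41 : 4 * q * (eta * beta) <= eta * beta by rewrite ger_pMl; lra.
  have : mu * (beta - 1) = 2 * (eta * beta) by rewrite /mu divfK ?gt_eqF.
  lra.
have [Ty|Ty] := leP (1 - eps) (T y); last first.
  have [_ -> -> _] := next_plain vy dy Ty.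
  have q40 : 0 <= 4 * q by lra.
  have hT : T y <= beta * y by rewrite /T /beta_shift lerBlDr lerDl.
  have := ler_wpM2l q40 hT; lra.
have [m [_ aE nE _ [h1 h2 h3]]] := next_bump vy dy Ty.
have e8 := eps_lt8.
have hT : T y <= beta * y by rewrite /T /beta_shift lerBlDr lerDl.
have : 1 / 2 <= beta * y by lra.
have k0 : 0 < beta ^- m by exact: expVn_gt0.
have h4 : next_state y <= beta ^- m.
  apply: le_trans (ltW h2) _; rewrite ger_pMr //; lra.
have q40 : 0 <= 4 * q by lra.
have := ler_wpM2l q40 h4.
rewrite mulrC in aE; rewrite aE.
have q41 : 4 * q * beta ^- m <= beta ^- m by rewrite ger_pMl //; lra.
move=> g1 g2.
have := ler_wpM2l q40 g2.
lra.
Qed.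

(* Right after a remainder between 1 - 6 q and 1 - eps, [off_one] forbids bumps
   for m0 steps, after which further additions are negligible. *)
Lemma addition_near_one y k : valid y -> 1 - 6 * q < y -> addition y k <= eps / 2.
Proof.
move=> vy hy; have /andP[y0 y1] := vy.
have [mu0 mu4] := mu_le; have q8 := q_le; have eq := eps_lt_q.
have mono i j : addition y i <= addition y (j + i).
  by rewrite addnC addition_cat lerDl mulr_ge0 ?addition_ge0 // ltW ?expVn_gt0.
suff alt i : (i <= m0)%N -> addition y k <= eps / 2 \/
    (iter i next_state y = iter i T y /\
    forall j, addition y (i + j) = beta ^- i * addition (iter i next_state y) j).
  case: (alt m0) => // -[_ hA]; apply: le_trans (mono _ m0) _; rewrite hA.
  have vm := valid_iter m0 vy; have /andP[m_0 m_1] := vm.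
  have bm0 : 0 < beta ^+ m0 by rewrite exprn_gt0.
  rewrite mulrC ler_pdivrMr //.
  apply: le_trans (addition_le k vm) _.
  have q40 : 0 <= 4 * q by lra.
  have z1 : iter m0 next_state y <= 1 by move: eps_gt0; lra.
  have := ler_wpM2l q40 z1; have := m0_large; lra.
elim: i => [|i IH] hi.
  by right; split=> // j; rewrite expr0 invr1 mul1r.
have [|h|[iE hA]] := IH; [exact: ltnW | by left |].
have vi := valid_iter i vy; set z := iter i next_state y in vi iE hA *.
(* If the state becomes negligible meanwhile, the potential is already at most 4 q delta + mu <= eps
   / 2. *)
have [zd|dz] := ltP z delta.
  left; apply: le_trans (mono _ i) _; rewrite hA.
  have /andP[z0 z1] := vi.
  have := addition_le k vi.
  have q40 : 0 <= 4 * q by lra.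
  have := ler_wpM2l q40 (ltW zd).
  have q4d : 4 * q * delta <= delta by rewrite ger_pMl //; lra.
  move=> g1 g2; have {g1 g2} g : addition z k <= eps / 2 by have := delta_eps; lra.
  apply: le_trans g; rewrite ler_piMl ?addition_ge0 //; exact: expVn_le1.
have Tz : T z < 1 - eps.
  rewrite iE -iterS -[y](_ : 1 - (1 - y) = y); last by ring.
  by apply: off_one => //; apply/andP; split; lra.
have [_ aE nE _] := next_plain vi dz Tz.
right; split; first by rewrite /= nE iE.
by move=> j; rewrite addSnnS hA additionS aE add0r /= -/z exprS invfM; ring.
Qed.

(** This is what makes emitted digits final. Up to 1 - 6 q there is room for the potential 4 q + mu,
    since mu < q; above it at most eps / 2 is added to y < 1 - eps. *)
Lemma tail_lt1 y : valid y -> exists2 B, B < 1 & forall k, y + addition y k <= B.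
Proof.
move=> vy; have [mu0 mu4] := mu_le; have q8 := q_le; have eq := eps_lt_q.
have /andP[y0 y1] := vy.
have [hy|hy] := ltP (1 - 6 * q) y.
  exists (y + eps / 2); first by lra.
  by move=> k; rewrite lerD2l; apply: addition_near_one.
exists (1 - 6 * q + 4 * q + mu); first by lra.
move=> k; have := addition_le k vy.
have q40 : 0 <= 4 * q by lra.
have y1' : y <= 1 by lra.
have := ler_wpM2l q40 y1'; lra.
Qed.

(** * Counting chips against digits *)

Lemma chip_countS y k : chip_count y k.+1 =
  (size (chips y) + chip_count (next_state y) k)%N.
Proof.
rewrite /chip_count big_ord_recl; congr (_ + _)%N.
by apply: eq_bigr => i _; rewrite /= -iterSr.
Qed.

Lemma digit_count_cat y j k : digit_count y (j + k) =
  (digit_count y j + digit_count (iter j next_state y) k)%N.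
Proof.
rewrite /digit_count big_split_ord; congr (_ + _)%N.
by apply: eq_bigr => i _ /=; rewrite addnC iterD.
Qed.

Lemma chip_count_cat y j k : chip_count y (j + k) =
  (chip_count y j + chip_count (iter j next_state y) k)%N.
Proof.
rewrite /chip_count big_split_ord; congr (_ + _)%N.
by apply: eq_bigr => i _ /=; rewrite addnC iterD.
Qed.

Lemma size_chips_le y : (size (chips y) <= (size xs).+1)%N.
Proof. by rewrite /chips; case: ifP => // _; case: ifP. Qed.

Lemma chips_pos y o : o \in chips y -> (0 < o)%N.
Proof.
rewrite /chips; case: ifP => _; first exact: xs_pos.
by case: ifP => // _; rewrite inE => /eqP ->.
Qed.

(** For [n] steps the states follow the orbit of eta, raised by beta^i y, so the digits of the
    configuration are emitted and no further chip is placed. The states cannot drop below [delta] in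
    between because the nonzero digit at index n - 1 is still to come. *)
Lemma gain_low y : valid y -> y < delta -> (chip_count y n < digit_count y n)%N.
Proof.
move=> vy yd; have /andP[y0 y1] := vy.
have bn := exprn_gt0 n b0.
have orb_ge j : (j < n)%N -> delta <= iter j T eta.
  move=> jn.
  have pos k : 0 <= iter k T eta.
    by case: k => [|k] /=; [exact: ltW | elim: k => [|k] /=;
      [case/andP: (beta_shift_bounds beta_gt1 (ltW eta_gt0))
      |move/(beta_shift_bounds beta_gt1)/andP=> [] ]].
  have up k i : iter (i + k) T eta <= beta ^+ i * iter k T eta.
    elim: i => [|i IH]; first by rewrite mul1r.
    rewrite addSn /= {1}/T /beta_shift exprS -mulrA lerBlDr.
    apply: le_trans (ler_wpM2l (ltW b0) IH) _; by rewrite lerDl.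
  have l1 : 1 <= beta * iter n.-1 T eta.
    by move: last_digit; rewrite /first_digit truncn_gt0.
  have := up j (n.-1 - j)%N; rewrite subnK; last by rewrite -ltnS prednK.
  move=> h; have {h} := ler_wpM2l (ltW b0) h; rewrite mulrA -exprS => h.
  have {h l1} h := le_trans l1 h.
  have h2 : 1 <= beta ^+ n * iter j T eta.
    apply: le_trans h _; rewrite ler_wpM2r // ler_weXn2l ?(ltW beta_gt1) //.
    by rewrite -subn1; clear -jn; lia.
  have : beta ^+ n * delta < beta ^+ n * iter j T eta.
    apply: lt_le_trans h2; apply: lt_trans delta_n _; have := eps_lt8; lra.
  by rewrite ltr_pM2l // => /ltW.
have [_ aE _] := next_low vy yd.
have st i : (0 < i <= n)%N -> iter i next_state y = iter i T (y + eta).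
  case: i => // i; rewrite ltnS; elim: i => [|i IH] hi.
    by rewrite /= /next_state aE.
  rewrite iterS IH ?(ltnW hi) // [RHS]iterS.
  have [hE _] := iter_low vy yd (ltnW hi).
  have dz : delta <= iter i.+1 T (y + eta).
    rewrite hE; apply: le_trans (orb_ge _ hi) _.
    by rewrite lerDl mulr_ge0 // exprn_ge0 // ltW.
  have vz : valid (iter i.+1 T (y + eta)).
    apply/andP; split; last exact: low_orbit_lt (ltnW hi).
    exact: le_trans (ltW delta_gt0) dz.
  by have [_ _ -> _] := next_plain vz dz (low_orbit_lt vy yd hi).
have later i : (0 < i < n)%N -> chips (iter i next_state y) = [::] /\
    emitted (iter i next_state y) = first_digit beta (iter i T eta).
  move=> /andP[i0 hi]; rewrite st ?i0 ?(ltnW hi) //.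
  have [hE _] := iter_low vy yd (ltnW hi).
  have dz : delta <= iter i T (y + eta).
    rewrite hE; apply: le_trans (orb_ge _ hi) _.
    by rewrite lerDl mulr_ge0 // exprn_ge0 // ltW.
  have vz : valid (iter i T (y + eta)).
    apply/andP; split; last exact: low_orbit_lt (ltnW hi).
    exact: le_trans (ltW delta_gt0) dz.
  have [-> _ _ ->] := next_plain vz dz (low_orbit_lt vy yd hi).
  by have [_ ->] := iter_low vy yd hi.
have -> : chip_count y n = size xs.
  have [cE _ _] := next_low vy yd.
  rewrite /chip_count -(prednK n_gt0) big_ord_recl /= cE big1 ?addn0 // => i _.
  by have [-> _] := later i.+1 ltac:(by rewrite /= -[X in (_ < X)%N](prednK n_gt0) ltnS).
apply: leq_trans many_digits _; rewrite /digit_count leq_eqVlt; apply/orP; left.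
apply/eqP; apply: eq_bigr => -[[|i] hi] _ /=.
  by rewrite /emitted aE; have [_ /(_ 0%N isT)] := iter_low vy yd n_gt0.
by have [_ ->] := later i.+1 hi.
Qed.

(** While the digits are 0 and no bump occurs, the state is multiplied by beta, which cannot last
    for [w] steps. *)
Lemma wait y w : valid y -> delta <= y -> 1 <= beta ^+ w * y ->
  exists i, let z := iter i next_state y in
  [/\ (i < w)%N, z = beta ^+ i * y, chip_count y i = 0%N & delta <= z]
  /\ ((0 < first_digit beta z)%N \/ 1 - eps <= T z).
Proof.
elim: w y => [|w IH] y vy dy; have /andP[y0 y1] := vy.
  by rewrite mul1r => h; move: (le_lt_trans h y1) eps_gt0; lra.
move=> hw; have c0 : chip_count y 0 = 0%N by rewrite /chip_count big_ord0.
have [d0|dpos] := posnP (first_digit beta y); last first.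
  by exists 0%N; split; [split; rewrite //= mul1r | left].
have [Ty|Ty] := leP (1 - eps) (T y).
  by exists 0%N; split; [split; rewrite //= mul1r | right].
have [cE _ nE _] := next_plain vy dy Ty.
have nE' : next_state y = beta * y by rewrite nE /T /beta_shift d0 subr0.
have [||i [[iw zE ci dz] hz]] := IH (next_state y) (valid_next vy).
- by rewrite nE'; apply: le_trans dy _; rewrite ler_peMl // ltW.
- by rewrite nE' mulrA -exprSr.
exists i.+1; rewrite iterSr; split=> //; split=> //.
- by rewrite zE nE' mulrA -exprSr.
- by rewrite chip_countS cE ci.
Qed.

Lemma wait_bound : exists w : nat, forall y, delta <= y -> 1 <= beta ^+ w * y.
Proof.
have [w hw] := expr_unbounded beta_gt1 delta^-1; exists w => y dy.
have := ltW hw; rewrite -[delta^-1]mul1r ler_pdivrMr // => /le_trans -> //.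
by rewrite ler_wpM2l // exprn_ge0 // ltW.
Qed.

(** A nonzero [first_digit] is a gain even if a bump occurs at the same step, and a negligible state
    gains by its configuration. Only a bump over a zero digit is neutral, and the next event after
    it cannot be of the same kind. *)
Lemma gain : exists2 W, (0 < W)%N & forall y, valid y ->
  exists l, (0 < l <= W)%N /\ (chip_count y l < digit_count y l)%N.
Proof.
have [w hw] := wait_bound.
exists (w.+1 + w.+1 + n)%N => // y vy.
have [yd|dy] := ltP y delta.
  by exists n; rewrite n_gt0 leq_addl; split=> //; apply: gain_low.
have digit_gain z : valid z -> delta <= z -> (0 < first_digit beta z)%N ->
    (size (chips z) < emitted z)%N.
  move=> vz dz d0; have [Tz|Tz] := leP (1 - eps) (T z).
    by have [m [-> _ _ -> _]] := next_bump vz dz Tz.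
  by have [-> _ _ ->] := next_plain vz dz Tz.
have single z : chip_count z 1 = size (chips z) /\ digit_count z 1 = emitted z.
  by rewrite /chip_count /digit_count !big_ord_recl !big_ord0 !addn0.
have waited z i : chip_count z i = 0%N ->
    (size (chips (iter i next_state z)) < emitted (iter i next_state z))%N ->
    (chip_count z i.+1 < digit_count z i.+1)%N.
  move=> ci h; rewrite -(addn1 i) chip_count_cat digit_count_cat ci.
  have [-> ->] := single (iter i next_state z).
  by rewrite add0n; apply: leq_trans h (leq_addl _ _).
have [i [[iw zE ci dz] hz]] := wait vy dy (hw _ dy).
set z := iter i next_state y in zE dz hz; have vz := valid_iter i vy.
rewrite -/z in vz.
have [d0|dpos] := posnP (first_digit beta z); last first.
  exists i.+1; split; first by clear -iw; lia.
  by apply: waited => //; apply: digit_gain.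
case: hz => [|Tz]; first by rewrite d0.
have [m [cz aE nE eE [h1 h2 h3]]] := next_bump vz dz Tz.
set z2 := next_state z in nE h1 h2.
have vz2 : valid z2 by apply: valid_next.
have z2E : iter i.+1 next_state y = z2 by [].
have cc : chip_count y i.+1 = 1%N.
  by rewrite -(addn1 i) chip_count_cat ci; have [-> _] := single z; rewrite -/z cz.
have dd : (1 <= digit_count y i.+1)%N.
  rewrite -(addn1 i) digit_count_cat; have [_ ->] := single z.
  by rewrite -/z eE addnS.
have combine l : (chip_count z2 l < digit_count z2 l)%N ->
    (chip_count y (i.+1 + l) < digit_count y (i.+1 + l))%N.
  by rewrite chip_count_cat digit_count_cat cc z2E; clear -dd; lia.
have [z2d|dz2] := ltP z2 delta.
  exists (i.+1 + n)%N; split; first by clear -iw; lia.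
  by apply: combine; apply: gain_low.
have [i2 [[iw2 uE ci2 du] hu]] := wait vz2 dz2 (hw _ dz2).
set u := iter i2 next_state z2 in uE du hu.
have vu : valid u by apply: valid_iter.
exists (i.+1 + i2.+1)%N; split; first by clear -iw iw2; lia.
apply/combine/waited => //; apply: digit_gain => //.
(* A second bump over a zero digit means that T u = beta^(i2+1) z2 is at least 1 - eps. As z2 < kap
   (1 - eps), this forces i2 + 1 > m, and then kap <= beta z2 gives T u >= 1. *)
case: hu => // Tu; rewrite lt0n; apply/negP => /eqP du0.
have TuE : T u = beta ^+ i2.+1 * z2.
  by rewrite /T /beta_shift du0 subr0 uE mulrA -exprS.
have e8 := eps_lt8; have e0 : 0 < 1 - eps by lra.
have k0 : 0 < beta ^- m by exact: expVn_gt0.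
have k1 : beta ^- m * beta ^+ m = 1 by rewrite mulVf // expf_neq0.
have bi0 : 0 < beta ^+ i2.+1 by rewrite exprn_gt0.
have /andP[_ Tu1] : 0 <= T u < 1.
  by apply: beta_shift_bounds => //; case/andP: vu.
have mi : (m < i2.+1)%N.
  have h4 : 1 - eps < beta ^+ i2.+1 * (beta ^- m * (1 - eps)).
    by apply: le_lt_trans Tu _; rewrite TuE ltr_pM2l.
  move: h4; rewrite mulrA -{1}[1 - eps]mul1r ltr_pM2r // => h4.
  by rewrite -(ltr_eXn2l beta_gt1) -[ltLHS]mul1r -ltr_pdivlMr ?exprn_gt0.
move: Tu1; rewrite ltNge => /negP; apply; rewrite TuE.
have : beta ^+ m * (beta * z2) <= beta ^+ i2.+1 * z2.
  rewrite mulrA -exprSr ler_wpM2r ?ler_weXn2l ?(ltW beta_gt1) //.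
  by case/andP: vz2.
apply: le_trans; rewrite -k1 mulrC ler_pM2l ?exprn_gt0 //.
Qed.

(** Windows of at most [W] steps, each with a gain, are chained; [C] covers the last incomplete one,
    in which at most (size xs + 1) W chips are placed. *)
Lemma total_gain : exists W C, (0 < W)%N /\ forall k y, valid y ->
  (W * chip_count y k + k <= W * digit_count y k + C)%N.
Proof.
have [W W0 hW] := gain.
exists W, (W * ((size xs).+1 * W) + W)%N; split=> // k y.
have cc z j : (chip_count z j <= (size xs).+1 * j)%N.
  rewrite mulnC -{2}(card_ord j) -sum_nat_const; apply: leq_sum => i _.
  exact: size_chips_le.
have [N] := ubnP k; elim: N k y => // N IH k y; rewrite ltnS => kN vy.
have [kW|Wk] := leqP k W.
  apply: leq_trans (leq_addl _ _); rewrite leq_add // leq_mul //.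
  by apply: leq_trans (cc _ _) _; rewrite leq_mul.
have [l [/andP[l0 lW] hl]] := hW _ vy.
have lk : (l < k)%N := leq_ltn_trans lW Wk.
have := IH (k - l)%N (iter l next_state y) _ (valid_iter l vy).
have := chip_count_cat y l (k - l); have := digit_count_cat y l (k - l).
rewrite (subnKC (ltnW lk)) => -> ->.
have -> : (k - l < N)%N by clear -l0 lk kN; lia.
move=> /(_ isT) {}IH.
have := leq_mul (leqnn W) hl.
move: IH; rewrite !mulnDr mulnS => IH h.
clear - IH h lW lk.
move: (W * chip_count y l)%N (W * chip_count _ _)%N (W * digit_count y l)%N
  (W * digit_count _ _)%N (W * _)%N IH h => a b c d e IH h; lia.
Qed.

End Process.

(** The order of the choices avoids circularity: K = q / eps and [m0] depend on beta only, then
    [eps] depends on [m0] and [th], then the configuration is scaled down relative to [eps], and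
    [delta] comes last because it depends on the length [n]. *)
Lemma not_reducible_gain (R : realType) (beta : R) : 1 < beta ->
  ~ greedy_reducible beta ->
  exists (u : R) (e : nat -> nat) (c : nat -> seq nat),
  [/\ 0 < u,
      forall k, 0 <= u - \sum_(j < k) (e j)%:R * beta ^- j.+1 < beta ^- k,
      (forall k, \sum_(j < k) beta ^- j * \sum_(o <- c j) beta ^- o <= u) /\
      (forall z, 0 < z -> exists k,
         u - z < \sum_(j < k) beta ^- j * \sum_(o <- c j) beta ^- o),
      (forall k o, o \in c k -> (0 < o)%N) /\
      (exists N, forall k, (size (c k) <= N)%N)
    & exists W C, (0 < W)%N /\ forall k,
      (W * \sum_(j < k) size (c j) + k <= W * \sum_(j < k) e j + C)%N].
Proof.
move=> beta_gt1 /(not_reducible_chips beta_gt1)[N [th [th1 hth]]].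
have b0 := beta_gt0 beta_gt1; have b1 := beta_sub1_gt0 beta_gt1.
pose K := beta ^+ 2 / (beta - 1).
have K0 : 0 < K by rewrite divr_gt0 // exprn_gt0.
have [m0 hm0] := expr_unbounded beta_gt1 (10 * K).
have [e0 e00 off] := iter_shift_off_one beta_gt1 m0 (6 * K).
pose eps := Order.min (e0 / 2) (Order.min ((1 - th) / 2) ((8 * K)^-1)).
have eps_gt0 : 0 < eps.
  by rewrite !lt_min !divr_gt0 ?subr_gt0 //= invr_gt0 mulr_gt0.
have [eps1 eps2 eps3] : [/\ eps < e0, eps <= (1 - th) / 2 & eps <= (8 * K)^-1].
  split; first (apply: le_lt_trans (_ : e0 / 2 < e0); last by lra).
  - by rewrite ge_min lexx.
  - by rewrite !ge_min lexx orbT.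
  - by rewrite !ge_min lexx !orbT.
pose q := eps * K.
have qE : q * (beta - 1) = eps * beta ^+ 2.
  by rewrite /q /K -mulrA divfK // gt_eqF.
have q_le : q <= 1 / 8.
  have K8 : 0 < 8 * K by rewrite mulr_gt0.
  have := ler_wpM2r (ltW K8) eps3; rewrite mulVf ?gt_eqF // /q; lra.
have th_eps : th + 2 * eps <= 1 by lra.
have m0_large : 10 * q <= eps * beta ^+ m0.
  by rewrite /q mulrCA ler_pM2l // ltW.
have off_one m s : (0 < m <= m0)%N -> eps < s < 6 * q ->
    iter m (beta_shift beta) (1 - s) < 1 - eps.
  move=> hm hs; apply: off => //; first by rewrite eps_gt0.
  by rewrite mulrAC -mulrA.
have zeta0 : 0 < eps * (beta - 1) / (8 * beta) by rewrite divr_gt0 // !mulr_gt0.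
have [xs [n /= [szx xs_pos /andP[eta0 eta_lt] n0 [orb many last]]]] := hth _ zeta0.
rewrite -szx in many.
have eta_small : 8 * ((\sum_(o <- xs) beta ^- o) * beta) <= eps * (beta - 1).
  have b8 : 0 < 8 * beta by rewrite mulr_gt0.
  by move: eta_lt; rewrite ltr_pdivlMr // mulrCA => /ltW.
pose delta := eps / (8 * beta ^+ n).
have bn0 : 0 < beta ^+ n by rewrite exprn_gt0.
have bn1 : 1 <= beta ^+ n by rewrite exprn_ege1 // ltW.
have delta0 : 0 < delta by rewrite divr_gt0 // mulr_gt0.
have delta_nE : beta ^+ n * delta = eps / 8.
  by rewrite /delta; field; rewrite gt_eqF.
have delta_n : beta ^+ n * delta < eps by rewrite delta_nE; lra.
have delta_eps : 4 * delta <= eps.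
  have : delta <= beta ^+ n * delta by rewrite ler_peMl // ltW.
  rewrite delta_nE; lra.
have v0 : valid eps (0 : R).
  rewrite /valid lexx subr_gt0 /=.
  have : eps < q by apply: (eps_lt_q beta_gt1 eps_gt0 qE).
  lra.
pose st k := iter k (next_state beta xs eps delta) 0.
have vst k : valid eps (st k).
  by apply: (valid_iter beta_gt1 eta0 n0 orb eps_gt0 qE q_le th_eps delta_n).
have tail k := tail_lt1 beta_gt1 eta0 n0 orb eps_gt0 qE q_le th_eps m0_large
  off_one eta_small delta0 delta_eps delta_n (vst k).
pose A k := addition beta xs eps delta 0 k.
have A_cat j k : A (j + k)%N = A j + beta ^- j * addition beta xs eps delta (st j) k.
  exact: addition_cat.
have A_mono j k : A j <= A (j + k)%N.
  rewrite A_cat lerDl mulr_ge0 ?addition_ge0 //.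
  by rewrite invr_ge0 exprn_ge0 // ltW.
have AE k : A k = emission beta xs eps delta 0 k + beta ^- k * st k.
  by have := conservation beta_gt1 xs eps delta 0 k; rewrite add0r.
(* The bound [B] is uniform in k: strict inequalities for the partial sums alone would be lost in
   the supremum. *)
have A_ub j : exists2 B, B < 1 &
    forall k, A k <= emission beta xs eps delta 0 j + beta ^- j * B.
  have [B B1 hB] := tail j; exists B => // k.
  apply: le_trans (A_mono k j) _; rewrite addnC A_cat AE -addrA -mulrDr lerD2l.
  by rewrite ler_wpM2l // invr_ge0 exprn_ge0 // ltW.
have supA : has_sup (range A).
  split; first by exists (A 0%N), 0%N.
  have [B _ hB] := A_ub 0%N; exists (emission beta xs eps delta 0 0 + beta ^- 0 * B).
  by move=> _ [k _ <-].
have leA k : A k <= sup (range A) by apply: sup_upper_bound => //; exists k.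
exists (sup (range A)), (fun k => emitted beta xs eps delta (st k)),
  (fun k => chips beta xs eps delta (st k)); split.
- apply: lt_le_trans (leA 1%N).
  have [_ aE _] := next_low beta xs v0 delta0.
  by rewrite /A /addition big_ord_recl big_ord0 addr0 /= expr0 invr1 mul1r aE.
- move=> k; rewrite -/(emission beta xs eps delta 0 k); apply/andP; split.
    rewrite subr_ge0; apply: le_trans (leA k); rewrite AE lerDl.
    rewrite mulr_ge0 ?invr_ge0 ?exprn_ge0 ?(ltW b0) //.
    by case/andP: (vst k).
  have [B B1 hB] := A_ub k; rewrite ltrBlDl.
  apply: (@le_lt_trans _ _ (emission beta xs eps delta 0 k + beta ^- k * B)).
    by apply: ge_sup; [exists (A 0%N), 0%N | move=> _ [j _ <-]].
  by rewrite ltrD2l gtr_pMr // invr_gt0 exprn_gt0.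
- split=> [k|z z0]; first exact: leA.
  have [_ [k _ <-] hk] := sup_adherent z0 supA; by exists k.
- split=> [k o|]; first exact: chips_pos.
  by exists (size xs).+1 => k; apply: size_chips_le.
- have [W [C [W0 hWC]]] := total_gain beta_gt1 eta0 n0 orb many last eps_gt0 qE
    q_le th_eps delta0 delta_n.
  by exists W, C; split=> // k; apply: hWC.
Qed.

(** * Digit sequences and beta expansions *)

Section SumUpto.
Variables (V : nmodType) (J : option int) (f : int -> V) (a : int).
Hypotheses (f_lt : forall j, j < a -> f j = 0)
  (f_from : forall j, ~ from J j -> f j = 0).

Lemma sum_upto_lt k : k < a -> sum_upto J f k = 0.
Proof.
move=> ka; apply: fsbig1 => j [_ jk]; apply: f_lt; exact: le_lt_trans jk ka.
Qed.

Lemma sum_upto_shift n : sum_upto J f (a + n%:Z) = \sum_(i < n.+1) f (a + i%:Z).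
Proof.
pose r := [seq a + i%:Z | i <- iota 0 n.+1].
have ur : uniq r by rewrite map_inj_uniq ?iota_uniq // => i j /addrI [].
have rP j : reflect (a <= j /\ j <= a + n%:Z) (j \in r).
  apply: (iffP mapP) => [[i + ->]|[h1 h2]]; first by rewrite mem_iota; lia.
  by exists `|j - a|%N; rewrite ?mem_iota; lia.
rewrite -(big_mkord xpredT (fun i => f (a + i%:Z))) /index_iota subn0.
rewrite -(big_map (fun i : nat => a + i%:Z) xpredT f) -/r fsbig_seq //.
rewrite /sum_upto.
set P := [set j | from J j /\ j <= a + n%:Z].
transitivity (\sum_(i \in P `&` [set` r]) f i).
  apply/esym; apply: fsbig_widen => [j []|j /= [[fj jn] hn]] //.
  apply: f_lt; rewrite ltNge; apply/negP => aj; apply: hn; split=> //.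
  by apply/rP.
apply: fsbig_widen => [j []|j /= [/rP[h1 h2] hn]] //.
apply: f_from => fj; apply: hn; split=> //.
by apply/rP.
Qed.

Lemma sum_upto_succ k : sum_upto J f (k + 1) = sum_upto J f k + f (k + 1).
Proof.
have [h|h] := ltP (k + 1) a.
  by rewrite !sum_upto_lt ?f_lt ?addr0 //; lia.
have [h2|h2] := ltP k a.
  rewrite (_ : k + 1 = a + 0%N%:Z); last by lia.
  by rewrite sum_upto_shift big_ord_recr big_ord0 sum_upto_lt.
have -> : k = a + `|k - a|%N%:Z by lia.
set n := `|k - a|%N; have -> : a + n%:Z + 1 = a + n.+1%:Z by lia.
by rewrite !sum_upto_shift big_ord_recr.
Qed.

End SumUpto.

Section ZeroBelow.
Implicit Types (J : option int) (d : int -> nat) (a : int).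

Definition zero_below J a d : Prop :=
  (forall j, j < a -> d j = 0%N) /\ (forall j, ~ from J j -> d j = 0%N).

Lemma digit_seq_zero_below J d : digit_seq J d -> exists a, zero_below J a d.
Proof.
case: J => [m|] /=; rewrite /zero_below /from.
  by move=> h; exists m; split=> // j /negP; rewrite -ltNge; apply: h.
move=> /finite_seqP[s hs].
have [a [ha a0]] : exists a : int, (forall j, j \in s -> a <= j) /\ a <= 0.
  elim: (s) => [|x s' [a [IH a0]]]; first by exists 0.
  exists (Order.min a x); split=> [j|]; last by rewrite ge_min a0.
  rewrite inE => /orP[/eqP ->|/IH h]; first by rewrite ge_min lexx orbT.
  by rewrite ge_min h.
exists a; split=> [j ja|j /(_ I)] //; apply: contrapT => dj.
have : [set` s] j by rewrite -hs; split=> //; lia.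
by move=> /ha; lia.
Qed.

Lemma zero_below_le J a a' d : zero_below J a d -> a' <= a -> zero_below J a' d.
Proof. by move=> [h1 h2] aa; split=> // j ja; apply: h1; lia. Qed.

Lemma zero_below_digit_seq J a d : zero_below J a d -> digit_seq J d.
Proof.
move=> [h1 h2]; case: J h2 => [m|] /= h2.
  by move=> j jm; apply: h2; rewrite /from /= leNgt jm.
apply: (@sub_finite_set _ _ [set` [seq a + i%:Z | i <- iota 0 `|a|%N]]).
  move=> j /= [j0 dj]; apply/mapP; exists `|j - a|%N.
    rewrite mem_iota /= add0n; have [ja|] := ltP j a; last by lia.
    by exfalso; apply: dj; apply: h1.
  have [ja|] := ltP j a; last by lia.
  by exfalso; apply: dj; apply: h1.
exact: finite_seq.
Qed.

Lemma sum_digits_lt J a d k : zero_below J a d -> k < a -> sum_upto J d k = 0%N.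
Proof. by move=> [h1 h2]; apply: sum_upto_lt. Qed.

Lemma sum_digits_shift J a d n : zero_below J a d ->
  sum_upto J d (a + n%:Z) = (\sum_(i < n.+1) d (a + i%:Z)%R)%N.
Proof. by move=> [h1 h2]; apply: sum_upto_shift. Qed.

Lemma sum_digits_succ J a d k : zero_below J a d ->
  sum_upto J d (k + 1) = (sum_upto J d k + d (k + 1)%R)%N.
Proof. by move=> [h1 h2]; apply: (sum_upto_succ h1 h2). Qed.

End ZeroBelow.

Section Representations.
Variables (R : realType) (beta : R).
Hypothesis beta_gt1 : 1 < beta.
Let b0 : 0 < beta := beta_gt0 beta_gt1.

Lemma beta_sum_lt J a d k : zero_below J a d -> k < a -> beta_sum J beta d k = 0.
Proof.
move=> [h1 h2] ka; apply: (@sum_upto_lt _ _ _ a) => // j hj.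
by rewrite h1 // mul0r.
Qed.

Lemma beta_sum_shift J a d n : zero_below J a d -> beta_sum J beta d (a + n%:Z) =
  \sum_(i < n.+1) (d (a + i%:Z))%:R * beta ^ (- (a + i%:Z)).
Proof.
move=> [h1 h2].
by apply: (@sum_upto_shift _ J (fun j => (d j)%:R * beta ^ (- j)) a) => j hj;
  [rewrite h1 // mul0r | rewrite h2 // mul0r].
Qed.

Lemma beta_sum_succ J a d k : zero_below J a d -> beta_sum J beta d (k + 1) =
  beta_sum J beta d k + (d (k + 1))%:R * beta ^ (- (k + 1)).
Proof.
move=> [h1 h2].
by apply: (@sum_upto_succ _ J (fun j => (d j)%:R * beta ^ (- j)) a) => j hj;
  [rewrite h1 // mul0r | rewrite h2 // mul0r].
Qed.

Lemma beta_sum_mono J d k (n : nat) : digit_seq J d ->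
  beta_sum J beta d k <= beta_sum J beta d (k + n%:Z).
Proof.
move=> /digit_seq_zero_below[a z]; elim: n => [|n IH]; first by rewrite addr0.
have -> : k + n.+1%:Z = k + n%:Z + 1 by lia.
apply: le_trans IH _; rewrite (beta_sum_succ _ z) lerDl mulr_ge0 //.
exact/ltW/expz_gt0.
Qed.

Lemma beta_sum_le J d k k' : digit_seq J d -> k <= k' ->
  beta_sum J beta d k <= beta_sum J beta d k'.
Proof.
move=> ds kk; have -> : k' = k + `|k' - k|%N%:Z by lia.
exact: beta_sum_mono.
Qed.

(** Partial sums are nondecreasing, so convergence to u means that u is their least upper bound, and
    k may range over all integers. *)
Lemma representationP J u d : beta_representation J beta u d <->
  [/\ digit_seq J d, forall k, beta_sum J beta d k <= u
    & forall z, 0 < z -> exists k, u - z < beta_sum J beta d k].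
Proof.
split=> [[ds cv]|[ds ub ad]].
  have nd : nondecreasing_seq (fun n : nat => beta_sum J beta d n%:Z).
    by move=> i j ij; apply: beta_sum_le => //; lia.
  have leu n : beta_sum J beta d n%:Z <= u.
    have := nondecreasing_cvgn_le nd (cvgP _ cv) n.
    by rewrite (cvg_lim (@Rhausdorff R) cv).
  split=> // [k|z z0].
    apply: le_trans (leu `|k|%N); apply: beta_sum_le => //; lia.
  have /cvgrPdist_lt /(_ z z0) [N _ hN] := cv.
  exists N%:Z; have := hN N (leqnn N); rewrite /= ger0_norm ?subr_ge0 //; lra.
split=> //; apply/cvgrPdist_lt => z z0.
have [k hk] := ad z z0; exists `|k|%N => // n /= kn.
rewrite ger0_norm ?subr_ge0 //.
have : beta_sum J beta d k <= beta_sum J beta d n%:Z.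
  by apply: beta_sum_le => //; lia.
lra.
Qed.

Lemma expz_small z : 0 < z -> exists n : nat, forall k, n%:Z <= k -> beta ^ (- k) < z.
Proof.
move=> z0; have [n hn] := expr_unbounded beta_gt1 z^-1; exists n => k nk.
apply: (@le_lt_trans _ _ (beta ^ (- n%:Z))); first by rewrite ler_eXz2l // lerN2.
by rewrite -invr_expz invf_plt // posrE exprn_gt0.
Qed.

Lemma expansion_intro J u d a : zero_below J a d ->
  (forall k, from J k -> k < a -> 0 <= u < beta ^ (- k)) ->
  (forall n : nat, 0 <= u - \sum_(i < n.+1) (d (a + i%:Z))%:R * beta ^ (- (a + i%:Z))
                     < beta ^ (- (a + n%:Z))) ->
  is_beta_expansion J beta u d.
Proof.
move=> z hlt hge; have ds := zero_below_digit_seq z.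
have rem n : 0 <= u - beta_sum J beta d (a + n%:Z) < beta ^ (- (a + n%:Z)).
  by rewrite (beta_sum_shift _ z).
split.
  apply/representationP; split=> // [k|e e0].
    apply: (@le_trans _ _ (beta_sum J beta d (a + `|k - a|%N%:Z))).
      by apply: beta_sum_le => //; lia.
    by have /andP[+ _] := rem `|k - a|%N; rewrite subr_ge0.
  have [n hn] := expz_small e0; exists (a + `|n%:Z - a|%N%:Z).
  have /andP[_ h] := rem `|n%:Z - a|%N.
  have := hn (a + `|n%:Z - a|%N%:Z) ltac:(lia); lra.
move=> k fk; have [ka|ak] := ltP k a.
  by rewrite (beta_sum_lt z ka) subr0; apply: hlt.
have -> : k = a + `|k - a|%N%:Z by lia.
exact: rem.
Qed.

Lemma expansion_unique J u d d' : is_beta_expansion J beta u d ->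
  is_beta_expansion J beta u d' -> d = d'.
Proof.
move=> [[ds _] r] [[ds' _] r'].
have [a1 z1] := digit_seq_zero_below ds.
have [a2 z2] := digit_seq_zero_below ds'.
pose a := Order.min a1 a2.
have z : zero_below J a d by apply: zero_below_le z1 _; rewrite ge_min lexx.
have z' : zero_below J a d' by apply: zero_below_le z2 _; rewrite ge_min lexx orbT.
have eqn n : d (a + n%:Z) = d' (a + n%:Z).
  have [N] := ubnP n; elim: N n => // N IH n; rewrite ltnS => nN.
  have [fk|nfk] := pselect (from J (a + n%:Z)); last first.
    by rewrite (z.2 _ nfk) (z'.2 _ nfk).
  have := r _ fk; have := r' _ fk.
  rewrite (beta_sum_shift _ z) (beta_sum_shift _ z') !big_ord_recr /=.
  rewrite (eq_bigr (fun i : 'I_n => (d (a + i%:Z))%:R * beta ^ (- (a + i%:Z)))).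
    set S := \sum_(_ < _) _; set x := beta ^ _.
    have x0 : 0 < x := expz_gt0 beta_gt1 _.
    move=> /andP[h1 h2] /andP[h3 h4].
    have aux (p q : nat) : 0 <= u - (S + p%:R * x) -> u - (S + q%:R * x) < x ->
        (p <= q)%N.
      move=> g1 g2; rewrite -ltnS -(ltr_nat R) -natr1 -(ltr_pM2r x0); lra.
    by apply/eqP; rewrite eqn_leq !aux.
  by move=> i _; rewrite IH //; apply: leq_trans nN.
apply/funext => j; have [ja|aj] := ltP j a.
  by rewrite (z.1 _ ja) (z'.1 _ ja).
have -> : j = a + `|j - a|%N%:Z by lia.
exact: eqn.
Qed.

Lemma expansion_exists J u : 0 < u -> exists d, is_beta_expansion J beta u d.
Proof.
move=> u0.
(* For finite J the digit at J takes the whole integer part [c] of u beta^J; for J = -oo the number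
   is scaled below 1 and c = 0. All later digits come from the beta-transformation. *)
have [a [c [y [y01 uE h]]]] : exists (a : int) (c : nat) (y : R), [/\ 0 <= y < 1,
    u = beta ^ (- a) * (c%:R + y) &
    (forall j, ~ from J j -> j < a) /\ (forall k, from J k -> k < a -> c = 0%N)].
  case: J => [m|].
    pose x := u * beta ^ m; have x0 : 0 <= x.
      by rewrite mulr_ge0 ?(ltW u0) // ltW // expz_gt0.
    have /andP[h1 h2] := truncn_itv x0.
    exists m, (Num.truncn x), (x - (Num.truncn x)%:R); split.
    - by rewrite subr_ge0 h1 ltrBlDl natr1.
    - rewrite subrKC /x mulrCA -expzD // addNr expr0z mulr1 //.
    - rewrite /from; split=> [j /negP|k /= mk km]; first by rewrite -ltNge.
      lia.
  have [n hn] := expr_unbounded beta_gt1 u.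
  have bn : 0 < beta ^+ n by rewrite exprn_gt0.
  exists (- n%:Z), 0%N, (u / beta ^+ n); split.
  - by rewrite divr_ge0 ?(ltW u0) ?(ltW bn) //= ltr_pdivrMr // mul1r.
  - by rewrite opprK add0r mulrC divfK // gt_eqF.
  - by split=> // j; rewrite /from => /(_ I).
have [hfrom hlow] := h.
have a0 := expz_gt0 beta_gt1 (- a).
pose dd (j : int) : nat := if j < a then 0%N else if j == a then c else
   first_digit beta (iter (absz (j - a)%R).-1 (beta_shift beta) y).
have dd0 : dd (a + 0%N%:Z) = c by rewrite /dd addr0 ltxx eqxx.
have ddS i : dd (a + i.+1%:Z) = first_digit beta (iter i (beta_shift beta) y).
  rewrite /dd ifF; last by clear; lia.
  rewrite ifF; last by clear; lia.
  by have -> : (absz (a + i.+1%:Z - a)%R).-1 = i by clear; lia.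
exists dd.
apply: (expansion_intro (a := a)).
- by split=> [j|j /hfrom] h1; rewrite /dd h1.
- move=> k fk ka; rewrite uE (hlow _ fk ka) add0r.
  have /andP[y0 y1] := y01; rewrite mulr_ge0 ?(ltW a0) //=.
  apply: (@lt_trans _ _ (beta ^ (- a))); first by rewrite gtr_pMr.
  by rewrite ltr_eXz2l // ltrN2.
- move=> n; rewrite big_ord_recl dd0 addr0.
  rewrite (eq_bigr (fun i : 'I_n => beta ^ (- a) *
    ((first_digit beta (iter i (beta_shift beta) y))%:R * beta ^- i.+1))); last first.
    by move=> i _; rewrite ddS opprD expzD // -[beta ^ (- _%:Z)]invr_expz mulrCA.
  rewrite -mulr_sumr.
  have e := shift_expansion beta_gt1 y n.
  set S := \sum_(_ < _) _ in e *.
  have -> : u - (c%:R * beta ^ (- a) + beta ^ (- a) * S) =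
      beta ^ (- a) * (beta ^- n * iter n (beta_shift beta) y).
    by rewrite uE {1}e; ring.
  rewrite opprD expzD // -[beta ^ (- n%:Z)]invr_expz.
  have /andP[t0 t1] := iter_shift_bounds beta_gt1 n y01.
  have bn := expVn_gt0 beta_gt1 n.
  by rewrite !mulr_ge0 ?(ltW a0) ?(ltW bn) //= ltr_pM2l // gtr_pMr.
Qed.

Lemma beta_expansionP J u : 0 < u ->
  is_beta_expansion J beta u (beta_expansion J beta u).
Proof. by move=> /(expansion_exists J) h; apply: xgetPex. Qed.

Lemma beta_expansion_eq J u d : 0 < u -> is_beta_expansion J beta u d ->
  beta_expansion J beta u = d.
Proof. by move=> u0 h; apply: expansion_unique h; apply: beta_expansionP. Qed.

End Representations.

(** * Average digits *)

Section AverageDigit.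
Variable R : realType.
Implicit Types (J : option int) (d : int -> nat).

Lemma limn_esup_le (u : nat -> \bar R) (M : \bar R) n0 :
  (forall n, (n0 <= n)%N -> (u n <= M)%E) -> (limn_esup u <= M)%E.
Proof.
move=> h; apply: (@le_trans _ _ (ereal_sup (u @` [set n | (n0 <= n)%N]))).
  by apply: ereal_inf_lbound; exists [set n | (n0 <= n)%N] => //; exists n0.
by apply: ge_ereal_sup => _ [n /= hn <-]; apply: h.
Qed.

Lemma limn_esup_lt (u : nat -> \bar R) (M : \bar R) : (limn_esup u < M)%E ->
  exists n0, forall n, (n0 <= n)%N -> (u n < M)%E.
Proof.
move=> /ereal_inf_lt[_ [V [n0 _ hV] <-] lt_M]; exists n0 => n hn.
by apply: le_lt_trans lt_M; apply: ereal_sup_ubound; exists n => //; apply: hV.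
Qed.

Lemma average_digit_le J d (M : R) n0 :
  (forall k, (n0 <= k)%N -> (sum_upto J d k%:Z)%:R <= M * k%:R) ->
  (average_digit R J d <= M%:E)%E.
Proof.
move=> h; apply: (@limn_esup_le _ _ n0.+1) => n hn; rewrite lee_fin.
rewrite ler_pdivrMr ?h ?ltr0n //; first exact: ltnW.
exact: leq_trans hn.
Qed.

Lemma average_digit_lt J d (M : R) : (average_digit R J d < M%:E)%E ->
  exists2 n0, (0 < n0)%N &
    forall k, (n0 <= k)%N -> (sum_upto J d k%:Z)%:R < M * k%:R.
Proof.
move=> /limn_esup_lt[n0 h]; exists n0.+1 => // k hk.
have := h k (ltnW hk); rewrite lte_fin ltr_pdivrMr // ltr0n.
exact: leq_trans hk.
Qed.

Lemma average_digit_ge0 J d : (0 <= average_digit R J d)%E.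
Proof.
rewrite leNgt; apply/negP => /average_digit_lt[n0 n00 /(_ n0 (leqnn _))].
by rewrite mul0r ltrn0.
Qed.

Lemma ereal_lt_real (x : \bar R) (M : R) : (x < M%:E)%E ->
  exists2 B : R, (x < B%:E)%E & B < M.
Proof.
case: x => [r||] //.
  rewrite lte_fin => h; exists ((r + M) / 2); rewrite ?lte_fin; lra.
by move=> _; exists (M - 1); rewrite ?ltNyr //; lra.
Qed.

Lemma ereal_le_real (x y : \bar R) : (0 <= y)%E ->
  (forall M : R, (y < M%:E)%E -> (x <= M%:E)%E) -> (x <= y)%E.
Proof.
case: y => [r||] // _ h; last by rewrite leey.
by apply/lee_addgt0Pr => e e0; apply: h; rewrite lte_fin ltrDl.
Qed.

Lemma archi_nat (x : R) : exists N : nat, forall k, (N <= k)%N -> x <= k%:R.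
Proof.
exists (Num.bound `|x|) => k hk.
apply: le_trans (ler_norm _) _; apply: le_trans (ltW (archi_boundP (normr_ge0 x))) _.
by rewrite ler_nat.
Qed.

Lemma average_digit_le_add J d J' d' (C : nat) :
  (forall k : nat, (sum_upto J d k%:Z <= sum_upto J' d' k%:Z + C)%N) ->
  (average_digit R J d <= average_digit R J' d')%E.
Proof.
move=> h; apply: ereal_le_real; first exact: average_digit_ge0.
move=> M /ereal_lt_real[B /average_digit_lt[n0 n00 hB] BM].
have D0 : 0 < M - B by rewrite subr_gt0.
have [N hN] := archi_nat (C%:R / (M - B)).
apply: (@average_digit_le _ _ _ (maxn n0 N)) => k; rewrite geq_max => /andP[k1 k2].
have := hN _ k2; rewrite ler_pdivrMr // => g1.
have := h k; rewrite -(ler_nat R) natrD => g2.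
have := hB _ k1; lra.
Qed.

End AverageDigit.

(** * Optimality of the greedy expansion in reducible bases *)

Section Optimality.
Variables (R : realType) (beta : R).
Hypothesis beta_gt1 : 1 < beta.
Let b0 : 0 < beta := beta_gt0 beta_gt1.

Lemma truncation_powers J d n : digit_seq J d -> exists s,
  power_sum beta s = beta_sum J beta d n /\ size s = sum_upto J d n.
Proof.
move=> /digit_seq_zero_below[a z]; have [na|an] := ltP n a.
  exists [::]; rewrite /power_sum big_nil.
  by rewrite (beta_sum_lt _ z na) (sum_digits_lt z na).
have -> : n = a + `|n - a|%N%:Z by lia.
rewrite (beta_sum_shift _ _ z) (sum_digits_shift _ z).
move: (`|n - a|%N.+1) => q; elim: q => [|m [s [v sz]]].
  by exists [::]; rewrite /power_sum big_nil !big_ord0.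
exists (s ++ nseq (d (a + m%:Z)) (- (a + m%:Z))).
rewrite power_sum_cat v size_cat sz size_nseq !big_ord_recr /=; split=> //.
by congr (_ + _); rewrite /power_sum big_nseq iter_addr_0 mulr_natl.
Qed.

(* At the first digit where the two expansions of v <= u differ the one of u
   is larger; each further unit it spends costs at least beta^-k in u - v. *)
Lemma greedy_compare u d s : is_beta_expansion None beta u d ->
  greedy beta s -> power_sum beta s <= u -> forall k,
  (sum_upto None d k)%:R <= (size s)%:R + 1 + beta ^ k * (u - power_sum beta s).
Proof.
move=> [[ds _] rem] gs le_u k.
have bk := expz_gt0 beta_gt1 k.
have rhs0 : 0 <= beta ^ k * (u - power_sum beta s).
  by rewrite mulr_ge0 ?subr_ge0 // ltW.
have [a1 z1] := digit_seq_zero_below ds.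
have [p0 hp0] : exists p : int, forall e, e \in s -> e <= p.
  elim: (s) => [|x s' [p IH]]; first by exists 0.
  exists (Order.max p x) => e; rewrite inE => /orP[/eqP ->|/IH h].
    by rewrite le_max lexx orbT.
  by rewrite le_max h.
pose a := Order.min a1 (- p0); pose p := - a.
have z : zero_below None a d by apply: zero_below_le z1 _; rewrite ge_min lexx.
have les e : e \in s -> e <= p.
  move=> /hp0 h; apply: le_trans h _; rewrite /p lerNr ge_min lexx orbT //.
have [ka|ak] := ltP k a.
  rewrite (sum_digits_lt z ka); apply: addr_ge0 => //; exact: addr_ge0.
have kE : k = a + `|k - a|%N%:Z by clear -ak; lia.
set m := `|k - a|%N in kE.
pose g l := d (a + l%:Z); pose c l := count_mem (p - l%:Z) s.
have FE : sum_upto None d k = (\sum_(l < m.+1) g l)%N.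
  by rewrite kE (sum_digits_shift _ z).
have ssize n : size s = (\sum_(l < n) c l + count (fun e => (e <= p - n%:Z)%R) s)%N.
  rewrite -sum1_size (@digits_split nat (fun=> 1%N) s p n les) sum1_count.
  by congr (_ + _)%N; apply: eq_bigr => l _; rewrite -[RHS]natn.
have [[i0 /andP[i0m hi0]]|hno] := pselect (exists i, (i < m.+1)%N && (g i != c i));
    last first.
  have : (sum_upto None d k <= size s)%N.
    rewrite FE (ssize m.+1); apply: leq_trans (leq_addr _ _).
    apply: leq_sum => i _; rewrite leq_eqVlt; apply/orP; left; apply/negPn/negP => hi.
    by apply: hno; exists i; rewrite ltn_ord.
  by rewrite -(ler_nat R); lra.
have ex : exists i, (i < m.+1)%N && (g i != c i) by exists i0; rewrite i0m.
case: (ex_minnP ex) => i /andP[im hi] hmin {i0 i0m hi0 ex}.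
have geq l : (l < i)%N -> g l = c l.
  move=> li; apply/eqP/negPn/negP => hl.
  have : (i <= l)%N by apply: hmin; rewrite hl andbT; apply: ltn_trans im.
  by rewrite leqNgt li.
have sumE : (\sum_(l < i) g l = \sum_(l < i) c l)%N.
  by apply: eq_bigr => l _; rewrite geq.
pose U := \sum_(l < i) (c l)%:R * beta ^ (p - l%:Z).
have expE l : - (a + l%:Z) = p - l%:Z by rewrite opprD.
have bs n : beta_sum None beta d (a + n%:Z) =
    \sum_(l < n.+1) (g l)%:R * beta ^ (p - l%:Z).
  rewrite (beta_sum_shift _ _ z); apply: eq_bigr => l _; by rewrite expE.
pose x := beta ^ (p - i%:Z); have x0 : 0 < x := expz_gt0 beta_gt1 _.
have UE : \sum_(l < i) (g l)%:R * beta ^ (p - l%:Z) = U.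
  by apply: eq_bigr => l _; rewrite geq.
have lowE : power_sum beta s = U + (c i)%:R * x +
    \sum_(e <- s | e < p - i%:Z) beta ^ e.
  rewrite /power_sum (digits_split _ i.+1 les) big_ord_recr /=.
  congr (_ + _ + _); [|by rewrite mulr_natl|].
    by apply: eq_bigr => l _; rewrite mulr_natl.
  by apply: eq_bigl => e; clear; lia.
have tail0 : 0 <= \sum_(e <- s | e < p - i%:Z) beta ^ e.
  by apply: sumr_ge0 => e _; rewrite ltW ?expz_gt0.
have tail1 := gs (p - i%:Z); rewrite -/x in tail1.
have /andP[_] := rem (a + i%:Z) I.
rewrite bs big_ord_recr /= UE expE -/x => rem_i.
have [lt_gc|lt_cg] : (g i < c i)%N \/ (c i < g i)%N.
  by move: hi; rewrite neq_ltn => /orP.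
  have : (g i)%:R * x + x <= (c i)%:R * x.
    by rewrite -[X in _ + X]mul1r -mulrDl natr1 ler_pM2r // ler_nat.
  lra.
have /andP[+ _] := rem k I; rewrite {1}kE bs subr_ge0.
rewrite -(subnKC im) big_split_ord big_ord_recr /= UE -/x => u_ge.
have : (\sum_(l < m.+1 - i.+1) g (i.+1 + l)%N)%:R * beta ^ (- k) <=
    \sum_(l < m.+1 - i.+1) (g (i.+1 + l)%N)%:R * beta ^ (p - (i.+1 + l)%N%:Z).
  rewrite natr_sum mulr_suml; apply: ler_sum => l _.
  rewrite ler_wpM2l // ler_eXz2l // kE /p; have := ltn_ord l; clear; lia.
set Q := (\sum_(l < m.+1 - i.+1) g (i.+1 + l))%N => hQ.
have xk : beta ^ (- k) <= x.
  rewrite ler_eXz2l // /p kE; clear -im; lia.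
have cg1 : 0 <= ((g i)%:R - (c i)%:R - 1 : R).
  by rewrite subr_ge0 lerBrDl natr1 ler_nat.
have h1 : ((g i)%:R - (c i)%:R - 1) * beta ^ (- k) + Q%:R * beta ^ (- k) <=
    u - power_sum beta s.
  have := ler_wpM2l cg1 xk; rewrite lowE; lra.
have h2 : (g i)%:R - (c i)%:R - 1 + Q%:R <= beta ^ k * (u - power_sum beta s).
  have := ler_wpM2l (ltW bk) h1.
  by rewrite -mulrDl mulrCA -expzD // subrr expr0z mulr1.
have h3 : (\sum_(l < i) c l + c i <= size s)%N.
  by rewrite (ssize i.+1) big_ord_recr /= leq_addr.
move: h3; rewrite -(ler_nat R) natrD => h3.
have -> : (sum_upto None d k)%:R = (\sum_(l < i) c l)%:R + (g i)%:R + Q%:R :> R.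
  by rewrite -!natrD FE -(subnKC im) big_split_ord big_ord_recr /= sumE.
lra.
Qed.

(* The tail \sum_(i > j) i beta^-i in closed form. *)
Let phi (j : nat) : R :=
  ((beta - 1)^-1 * j%:R + beta / (beta - 1) ^+ 2) * beta ^- j.

Let phiS j : phi j = phi j.+1 + j.+1%:R * beta ^- j.+1.
Proof.
rewrite /phi [beta ^+ j.+1]exprS -natr1; field.
by rewrite !gt_eqF ?subr_gt0 ?exprn_gt0.
Qed.

Let phi_ge0 j : 0 <= phi j.
Proof.
have b1 := ltW (beta_sub1_gt0 beta_gt1).
rewrite mulr_ge0 ?invr_ge0 ?exprn_ge0 ?(ltW b0) // addr_ge0 //.
  by rewrite mulr_ge0 // invr_ge0.
by rewrite divr_ge0 ?exprn_ge0 // ltW.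
Qed.

(** A bound B n on the digit sum gives just d_n <= B n for a single digit, hence the tail B \sum_(i
    > n) i beta^-i, which has an extra factor of order n. *)
Lemma representation_tail J u d (B : R) n0 : 0 <= B ->
  beta_representation J beta u d ->
  (forall n, (n0 <= n)%N -> (sum_upto J d n%:Z)%:R <= B * n%:R) ->
  forall n, (n0 <= n)%N -> u - beta_sum J beta d n%:Z <= B * phi n.
Proof.
move=> B0 /(representationP beta_gt1)[ds ub ad] hB n hn.
have [a z] := digit_seq_zero_below ds.
have step m : beta_sum J beta d (n + m)%N%:Z <=
    beta_sum J beta d n%:Z + B * (phi n - phi (n + m)).
  elim: m => [|m IH]; first by rewrite addn0 subrr mulr0 addr0.
  have -> : (n + m.+1)%N%:Z = (n + m)%N%:Z + 1 by rewrite addnS; lia.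
  rewrite (beta_sum_succ _ _ z) addnS.
  have := phiS (n + m)%N.
  have -> : beta ^ (- ((n + m)%N%:Z + 1)) = beta ^- (n + m).+1.
    have -> : (n + m)%N%:Z + 1 = (n + m).+1%:Z by clear; lia.
    by rewrite -invr_expz.
  have := hB (n + m).+1 (leq_trans hn (leqW (leq_addr _ _))).
  have e1 : (n + m).+1%:Z = (n + m)%N%:Z + 1 by lia.
  rewrite e1 (sum_digits_succ _ z) natrD => h1 h2.
  have v0 := expVn_gt0 beta_gt1 (n + m).+1.
  have S0 : 0 <= (sum_upto J d (n + m)%N%:Z)%:R :> R by [].
  have h3 : (d ((n + m)%N%:Z + 1))%:R <= B * (n + m).+1%:R by lra.
  have := ler_wpM2r (ltW v0) h3.
  rewrite -mulrA.
  have -> : B * ((n + m).+1%:R * beta ^- (n + m).+1) =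
    B * phi (n + m) - B * phi (n + m).+1 by rewrite h2; ring.
  lra.
rewrite leNgt; apply/negP => lt_u.
have [|k hk] := ad (u - beta_sum J beta d n%:Z - B * phi n); first by rewrite subr_gt0.
have := step `|k|%N.
have : beta_sum J beta d k <= beta_sum J beta d (n + `|k|)%N%:Z.
  by apply: beta_sum_le => //; lia.
have : 0 <= B * phi (n + `|k|) by rewrite mulr_ge0 ?phi_ge0.
lra.
Qed.

(** The representation is truncated [r] places after k. Its tail, scaled by beta^k, is at most B al
    beta^-r k plus a constant; [r] does not depend on k and makes the coefficient of k at most half
    of the gap M - B. The r extra places add only B r to the bound on the digit sum. *)
Lemma expansion_optimal J u d d' : greedy_reducible beta ->
  is_beta_expansion None beta u d -> beta_representation J beta u d' ->
  (average_digit R None d <= average_digit R J d')%E.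
Proof.
move=> red hd rep; apply: ereal_le_real; first exact: average_digit_ge0.
move=> M /ereal_lt_real[B /average_digit_lt[n0 n00 hB] BM].
have B0 : 0 <= B.
  have n0R : 0 < n0%:R :> R by rewrite ltr0n.
  rewrite -(ler_pM2r n0R) mul0r.
  by apply: le_trans (ltW (hB n0 (leqnn _))).
have tail := representation_tail B0 rep (fun n h => ltW (hB n h)).
have [ds ub _] := (representationP beta_gt1 J u d').1 rep.
have comp (k n : int) : (sum_upto None d k)%:R <=
    (sum_upto J d' n)%:R + 1 + beta ^ k * (u - beta_sum J beta d' n).
  have [s [vs ss]] := truncation_powers n ds.
  have [s' [g vs' ss']] := red s.
  have le_u : power_sum beta s' <= u by rewrite vs' vs.
  have := greedy_compare hd g le_u k; rewrite vs' vs.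
  move: ss'; rewrite ss -(ler_nat R) => ss'; lra.
pose al := (beta - 1)^-1; pose ga := beta / (beta - 1) ^+ 2.
have b1 := beta_sub1_gt0 beta_gt1.
have al0 : 0 < al by rewrite invr_gt0.
have ga0 : 0 < ga by rewrite divr_gt0 // exprn_gt0.
have D0 : 0 < M - B by rewrite subr_gt0.
have [r hr] := expr_unbounded beta_gt1 (2 * B * al / (M - B)).
have br0 : 0 < beta ^+ r by rewrite exprn_gt0.
have hr2 : B * al * beta ^- r <= (M - B) / 2.
  rewrite ler_pdivrMr //; move: hr; rewrite ltr_pdivrMr //.
  lra.
pose C := B * r%:R + 1 + B * (al * r%:R + ga) * beta ^- r.
have [N hN] := archi_nat (C / ((M - B) / 2)).
apply: (@average_digit_le _ _ _ _ (maxn n0 N)) => k; rewrite geq_max => /andP[k1 k2].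
have D20 : 0 < (M - B) / 2 by rewrite divr_gt0.
have := hN _ k2; rewrite ler_pdivrMr // => hC.
have h1 := comp k%:Z (k + r)%N%:Z.
have k1r : (n0 <= k + r)%N := leq_trans k1 (leq_addr _ _).
have h2 := ltW (hB _ k1r); rewrite natrD in h2.
have bk0 : 0 <= beta ^ k%:Z := ltW (expz_gt0 beta_gt1 _).
have h3 := ler_wpM2l bk0 (tail _ k1r).
have e : beta ^ k%:Z * (B * phi (k + r)) = B * al * beta ^- r * k%:R +
    B * (al * r%:R + ga) * beta ^- r.
  rewrite /phi -/al -/ga natrD exprD -[beta ^ k%:Z]/(beta ^+ k); field.
  by rewrite !expf_neq0 // gt_eqF.
have h4 := ler_wpM2r (ler0n R k) hr2.
move: h3; rewrite e => h3.
have : (sum_upto None d k%:Z)%:R <= B * (k%:R + r%:R) + 1 +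
   (B * al * beta ^- r * k%:R + B * (al * r%:R + ga) * beta ^- r) by lra.
move: hC; rewrite /C; lra.
Qed.

End Optimality.

(** * Conclusion *)

Section MonotoneExpansionsOfUnity.
Variables (R : realType) (beta : R).
Hypothesis beta_gt1 : 1 < beta.
Let b0 : 0 < beta := beta_gt0 beta_gt1.
Let bn0 : beta != 0 := beta_neq0 beta_gt1.

Lemma expz_oppS (n : nat) : beta ^ (- (1 + n%:Z)) = beta ^- n.+1.
Proof. by rewrite (_ : 1 + n%:Z = n.+1%:Z) // -invr_expz. Qed.

Lemma unity_data_MB t1 ps : unity_data beta t1 ps -> ps != [::] -> MB R beta.
Proof.
move=> data ps0; pose f (j : int) := if j < 1 then 0%N else unity_digit t1 ps `|j|%N.
have fS (i : nat) : f (1 + i%:Z) = unity_digit t1 ps i.+1.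
  have -> : 1 + i%:Z = i.+1%:Z by [].
  by rewrite /f.
have fE : expansion_of_unity beta = f.
  apply: beta_expansion_eq => //; apply: (expansion_intro beta_gt1 (a := 1)).
  - split=> j hj; rewrite /f; first by rewrite hj.
    by rewrite ltNge; case: ifP => // /negbFE /hj.
  - by rewrite /from => k k1; rewrite ltNge k1.
  - move=> n.
    rewrite (eq_bigr (fun i : 'I_n.+1 => (unity_digit t1 ps i.+1)%:R * beta ^- i.+1)).
      rewrite unity_partial_sum // subKr unity_remainder_ge0 //= expz_oppS.
      exact: unity_remainder_lt.
    by move=> i _; rewrite expz_oppS fS.
split=> // k k1; rewrite fE.
have -> : k = 1 + (absz k).-1%:Z by clear -k1; lia.
rewrite -addrA [_ + 1]addrC; have -> : 1 + (absz k).-1%:Z = (absz k).-1.+1%:Z by [].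
rewrite !fS /unity_digit leq_add2l; apply: sub_count => j /=; exact: ltnW.
Qed.

(** A nonincreasing digit sequence is constant from some [L] on, so only finitely many drops t_i -
    t_(i+1) are nonzero; they are the multiplicities in [ps]. Here [t] i is the digit at place i +
    1. Summation by parts gives the required relation up to the error beta r_(n+1) - r_n. *)
Lemma MB_unity_data : MB R beta -> exists t1 ps, unity_data beta t1 ps.
Proof.
move=> [_ mono].
have [[ds rep] rem] := beta_expansionP beta_gt1 (Some 1) (@ltr01 R).
rewrite -/(expansion_of_unity beta) in ds rep rem.
pose t l := expansion_of_unity beta (1 + l%:Z).
have tS l : (t l.+1 <= t l)%N.
  have := mono (1 + l%:Z) ltac:(lia); rewrite /t.
  by have -> : 1 + l%:Z + 1 = 1 + l.+1%:Z by clear; lia.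
have tmono l l' : (l <= l')%N -> (t l' <= t l)%N.
  move=> /subnKC <-; elim: (l' - l)%N => [|k IH]; first by rewrite addn0.
  by rewrite addnS; apply: leq_trans (tS _) IH.
have [L hL] : exists L, forall l, (L <= l)%N -> t l = t L.
  have exP : exists v, `[< exists l, t l = v >] by exists (t 0%N); apply/asboolP; exists 0%N.
  case: (ex_minnP exP) => v /asboolP[L tL] hv; exists L => l Ll.
  apply/eqP; rewrite eqn_leq tmono //= tL; apply: hv; apply/asboolP; by exists l.
pose r n : R := 1 - \sum_(i < n) (t i)%:R * beta ^- i.+1.
have rS n : r n = r n.+1 + (t n)%:R * beta ^- n.+1.
  by rewrite /r big_ord_recr /=; ring.
have z : zero_below (Some 1) 1 (expansion_of_unity beta).
  split=> j; last by move=> /= /negP; rewrite -ltNge; apply: ds.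
  exact: ds.
have r_bd n : 0 <= r n <= beta ^- n.
  case: n => [|n]; first by rewrite /r big_ord0 subr0 expr0 invr1 ler01 lexx.
  have := rem (1 + n%:Z) ltac:(by rewrite /from /= lerDl).
  rewrite (beta_sum_shift _ _ z) expz_oppS.
  rewrite (eq_bigr (fun i : 'I_n.+1 => (t i)%:R * beta ^- i.+1)).
    by rewrite -/(r n.+1) => /andP[-> /ltW ->].
  by move=> i _; rewrite expz_oppS.
pose q i := (t i - t i.+1)%N.
pose Q n : R := \sum_(i < n) (q i)%:R * beta ^- i.+1.
have QE n : Q n = (t 0%N).+1%:R - beta + (beta * r n.+1 - r n).
  rewrite -natr1; elim: n => [|n IH].
    rewrite /Q big_ord0 /r big_ord0 big_ord_recr big_ord0 expr1 /=.
    by field.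
  rewrite /Q big_ord_recr /= -/(Q n) IH /q natrB // (rS n.+1) (rS n).
  by rewrite (rS n.+1) [beta ^+ n.+2]exprS; field; rewrite bn0 expf_neq0.
have Qconst k : Q (L + k)%N = Q L.
  elim: k => [|k IH]; first by rewrite addn0.
  rewrite addnS /Q big_ord_recr /= -/(Q (L + k)%N) IH /q.
  rewrite (hL (L + k)%N) ?leq_addr // (hL (L + k).+1) ?leqW ?leq_addr //.
  by rewrite subnn mul0r addr0.
(* The error is at most beta^-n in absolute value and does not depend on n from [L] on, so it is
   0. *)
have QL : Q L = (t 0%N).+1%:R - beta.
  apply/eqP; rewrite -subr_eq0; apply/eqP; set x := _ - _.
  apply/eqP; apply/negPn/negP => x0.
  have [n hn] := expr_unbounded beta_gt1 (2 * `|x|^-1).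
  have bLn : 0 < beta ^+ (L + n) by rewrite exprn_gt0.
  have xE : x = beta * r (L + n).+1 - r (L + n)%N.
    by rewrite /x -(Qconst n) QE; ring.
  have /andP[r1 r2] := r_bd (L + n)%N; have /andP[r3 r4] := r_bd (L + n).+1.
  have r5 : beta * r (L + n).+1 <= beta ^- (L + n).
    apply: le_trans (ler_wpM2l (ltW b0) r4) _.
    by rewrite exprS invfM mulrA divff ?mul1r.
  have r6 : 0 <= beta * r (L + n).+1 by rewrite mulr_ge0 // ltW.
  have xle : `|x| <= beta ^- (L + n) by rewrite ler_norml xE; apply/andP; split; lra.
  have x0' : 0 < `|x| by rewrite normr_gt0.
  have : `|x| * beta ^+ (L + n) <= 1.
    by rewrite -(mulVf (lt0r_neq0 bLn)) ler_wpM2r // ltW.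
  have h1 : beta ^+ n <= beta ^+ (L + n).
    by rewrite ler_weXn2l ?leq_addl // ltW.
  have := ler_wpM2l (ltW x0') (le_trans (ltW hn) h1).
  rewrite mulrCA divff ?gt_eqF //; lra.
exists (t 0%N), (flatten [seq nseq (q i) i.+1 | i <- iota 0 L]); split.
- by move=> j /flatten_mapP[i _ /nseqP[-> _]].
- rewrite size_flatten /shape -map_comp sumnE big_map.
  have tele n : (\sum_(i <- iota 0 n) size (nseq (q i) i.+1) + t n = t 0)%N.
    elim: n => [|n IH]; first by rewrite big_nil.
    rewrite -addn1 iotaD big_cat big_seq1 /= size_nseq add0n -addnA.
    by rewrite /q addn1 subnK.
  by rewrite -(tele L) leq_addr.
- rewrite big_flatten big_map.
  have -> : \sum_(j <- iota 0 L) \sum_(i <- nseq (q j) j.+1) beta ^- i = Q L.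
    rewrite /Q -(big_mkord xpredT (fun i => (q i)%:R * beta ^- i.+1)).
    rewrite /index_iota subn0; apply: eq_bigr => i _.
    by rewrite big_nseq iter_addr_0 mulr_natl.
  by rewrite QL; ring.
Qed.

Lemma MB_greedy_reducible : MB R beta -> greedy_reducible beta.
Proof.
move=> /MB_unity_data[t1 [ps /(unity_carry_property beta_gt1)]].
exact: carry_greedy_reducible.
Qed.

End MonotoneExpansionsOfUnity.

(** * Digit sequences made of placed chips *)

Section ScheduledChips.
Variable c : nat -> seq nat.
Hypothesis c_pos : forall k o, o \in c k -> (0 < o)%N.

(** A chip placed at time [k] with offset [o] has exponent -(k + o); the index [i] stands for the
    place i + 1. *)
Definition chip_digit (i : nat) : nat :=
  \sum_(k < i.+1) count_mem (i.+1 - k)%N (c k).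

Lemma sum_chip_digit (V : nmodType) (f : nat -> V) n :
  \sum_(i < n) f i.+1 *+ chip_digit i =
  \sum_(k < n) \sum_(o <- c k | (k + o <= n)%N) f (k + o)%N.
Proof.
elim: n => [|n IH]; first by rewrite !big_ord0.
rewrite big_ord_recr /= IH.
have -> : \sum_(k < n) \sum_(o <- c k | (k + o <= n)%N) f (k + o)%N =
    \sum_(k < n.+1) \sum_(o <- c k | (k + o <= n)%N) f (k + o)%N.
  rewrite big_ord_recr /= [X in _ + X]big_seq_cond [X in _ + X]big1 ?addr0 //.
  by move=> o /andP[/c_pos h1 h2]; exfalso; clear -h1 h2; lia.
rewrite /chip_digit -sumrMnr -big_split; apply: eq_bigr => k _ /=.
rewrite [RHS](bigID (fun o => (k + o <= n)%N)) /=; congr (_ + _).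
  by apply: eq_bigl => o; clear; lia.
rewrite (eq_bigl (fun o => o == (n.+1 - k)%N)); last first.
  by move=> o; have := ltn_ord k; clear; lia.
rewrite (eq_bigr (fun=> f n.+1)); last first.
  by move=> o /eqP ->; congr f; have := ltn_ord k; clear; lia.
by rewrite big_const_seq iter_addr_0.
Qed.

Lemma sum_chip_digit_le n :
  (\sum_(i < n) chip_digit i <= \sum_(k < n) size (c k))%N.
Proof.
have := @sum_chip_digit nat (fun=> 1%N) n.
rewrite (eq_bigr (fun i : 'I_n => chip_digit i)) => [->|i _]; last exact: natn.
by apply: leq_sum => k _; rewrite -sum1_size [leqRHS](bigID (fun o => (k + o <= n)%N)) leq_addr.
Qed.

End ScheduledChips.

(** Both sequences are shifted by [s] places, so that they begin at a place allowed by J; the scaled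
    number is below beta^-s and has no earlier greedy digits. *)
Lemma not_reducible_example (R : realType) (beta : R) (J : option int) :
  1 < beta -> ~ greedy_reducible beta -> exists u : R, 0 < u /\
  (min_average_digit_at J beta u < expansion_average_digit_at J beta u)%E.
Proof.
move=> beta_gt1 /(not_reducible_gain beta_gt1)[u [e [c]]].
move=> [u0 rem [ub ad] [c_pos [N hN]] [W [C [W0 gain]]]].
have b0 := beta_gt0 beta_gt1.
have [s fromJ] : exists s : nat, forall j, ~ from J j -> j < s.+1%:Z.
  case: J => [m|]; last by exists 0%N => j /(_ I).
  by exists `|m|%N => j /= /negP; rewrite -ltNge => h; clear -h; lia.
pose a : int := s.+1%:Z.
pose v := beta ^- s * u.
have bs0 := expVn_gt0 beta_gt1 s.
have v0 : 0 < v by rewrite mulr_gt0.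
have u1 : u < 1 by have /andP[_] := rem 0%N; rewrite big_ord0 subr0 expr0 invr1.
pose shifted (g : nat -> nat) (j : int) : nat := if j < a then 0%N else g `|(j - a)%R|%N.
have zb g : zero_below J a (shifted g).
  by split=> j; [|move=> /fromJ]; rewrite /shifted => ->.
have shE g (i : nat) : shifted g (a + i%:Z) = g i.
  rewrite /shifted ifF; last by clear; lia.
  by congr g; clear; lia.
have expE (i : nat) : beta ^ (- (a + i%:Z)) = beta ^- s * beta ^- i.+1.
  have -> : a + i%:Z = s%:Z + i.+1%:Z by rewrite /a; clear; lia.
  by rewrite opprD expzD // -!invr_expz.
have sumE g n : \sum_(i < n) (shifted g (a + i%:Z))%:R * beta ^ (- (a + i%:Z)) =
    beta ^- s * \sum_(i < n) (g i)%:R * beta ^- i.+1.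
  by rewrite mulr_sumr; apply: eq_bigr => i _; rewrite shE expE mulrCA.
have exp_d : is_beta_expansion J beta v (shifted e).
  apply: (expansion_intro beta_gt1 (zb e)) => [k _ ka|n].
    rewrite ltW //=; apply: (@lt_le_trans _ _ (beta ^- s)).
      by rewrite gtr_pMr.
    have -> : beta ^- s = beta ^ (- s%:Z) by rewrite -invr_expz.
    by rewrite ler_eXz2l // lerN2; move: ka; rewrite /a; clear; lia.
  rewrite sumE -mulrBr expE; have /andP[h1 h2] := rem n.+1.
  by rewrite mulr_ge0 ?(ltW bs0) //= ltr_pM2l.
pose d' := shifted (chip_digit c).
have chipE n : \sum_(i < n) (chip_digit c i)%:R * beta ^- i.+1 =
    \sum_(k < n) \sum_(o <- c k | (k + o <= n)%N) beta ^- (k + o).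
  rewrite -(sum_chip_digit c_pos (fun p => beta ^- p)).
  by apply: eq_bigr => i _; rewrite mulr_natl.
have powE k (p : pred nat) : \sum_(o <- c k | p o) beta ^- (k + o) =
    beta ^- k * \sum_(o <- c k | p o) beta ^- o.
  by rewrite mulr_sumr; apply: eq_bigr => o _; rewrite exprD invfM.
have inner_le k (p : pred nat) :
    \sum_(o <- c k | p o) beta ^- o <= \sum_(o <- c k) beta ^- o.
  rewrite [leRHS](bigID p) /= lerDl sumr_ge0 // => o _.
  by rewrite ltW // expVn_gt0.
have pos_inner k (p : pred nat) : 0 <= \sum_(o <- c k | p o) beta ^- (k + o).
  by rewrite sumr_ge0 // => o _; rewrite ltW // expVn_gt0.
have rep_d' : beta_representation J beta v d'.
  apply/(representationP beta_gt1); split; first exact: zero_below_digit_seq (zb _).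
    move=> k; apply: (@le_trans _ _ (beta_sum J beta d' (a + `|(k - a)%R|%N%:Z))).
      apply: beta_sum_le => //; first exact: zero_below_digit_seq (zb _).
      by clear; lia.
    rewrite (beta_sum_shift _ _ (zb _)) sumE chipE /v ler_pM2l //.
    apply: le_trans (ub `|(k - a)%R|.+1); apply: ler_sum => i _.
    rewrite powE; apply: ler_wpM2l; first by rewrite ltW // expVn_gt0.
    exact: (inner_le i (fun o => (i + o <= _)%N)).
  move=> z z0; have [K hK] := ad _ (mulr_gt0 (exprn_gt0 s b0) z0).
  have [n [Kn hn]] : exists n, (K <= n.+1)%N /\
      forall k o, (k < K)%N -> o \in c k -> (k + o <= n.+1)%N.
    elim: (K) => [|k [n [kn IH]]]; first by exists 0%N.
    have [m hm] : exists m, forall o, o \in c k -> (o <= m)%N.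
      exists (\max_(o <- c k) o) => o ho; exact: leq_bigmax_seq.
    exists (n + k + m)%N; split=> [|i o]; first by clear -kn; lia.
    rewrite ltnS leq_eqVlt => /orP[/eqP -> /hm|ik /(IH _ _ ik)]; clear; lia.
  exists (a + n%:Z); rewrite (beta_sum_shift _ _ (zb _)) sumE chipE /v.
  have hP : \sum_(j < K) beta ^- j * \sum_(o <- c j) beta ^- o <=
      \sum_(k < n.+1) \sum_(o <- c k | (k + o <= n.+1)%N) beta ^- (k + o).
    rewrite -(subnKC Kn) big_split_ord /= subnKC //.
    rewrite -[leLHS]addr0; apply: lerD; last by apply: sumr_ge0.
    apply: ler_sum => k _; rewrite powE; apply: ler_wpM2l.
      by rewrite ltW // expVn_gt0.
    rewrite le_eqVlt; apply/orP; left; apply/eqP.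
    rewrite big_seq [RHS]big_seq_cond; apply: eq_bigl => o.
    by case ho : (o \in c k) => //=; rewrite hn.
  have := lt_le_trans hK hP; rewrite -(ltr_pM2l bs0); apply: le_lt_trans.
  by rewrite mulrBr mulrA mulVf ?mul1r // expf_neq0 // gt_eqF.
have sumF g n : sum_upto J (shifted g) (a + n%:Z) = (\sum_(i < n.+1) g i)%N.
  by rewrite (sum_digits_shift _ (zb g)); apply: eq_bigr => i _; rewrite shE.
have natE (k : nat) : a <= k%:Z -> exists2 n : nat, k%:Z = a + n%:Z & k = (s + n.+1)%N.
  by rewrite /a => h; exists (k - s.+1)%N; clear -h; lia.
have d'_le (k : nat) : (sum_upto J d' k%:Z <= N * k)%N.
  have [ka|/natE[n -> ->]] := ltP k%:Z a; first by rewrite (sum_digits_lt (zb _) ka).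
  rewrite sumF; apply: leq_trans (sum_chip_digit_le c_pos _) _.
  apply: (@leq_trans (n.+1 * N)%N); last by rewrite mulnC leq_mul2l leq_addl orbT.
  rewrite -[n.+1 in leqRHS]card_ord -sum_nat_const; apply: leq_sum => i _; exact: hN.
have gap (k : nat) : a <= k%:Z ->
    (W * sum_upto J d' k%:Z + k <= W * sum_upto J (shifted e) k%:Z + (C + s))%N.
  move=> /natE[n -> ->]; rewrite !sumF; have := gain n.+1.
  have := leq_mul (leqnn W) (sum_chip_digit_le c_pos n.+1).
  move: (W * _)%N (W * _)%N (W * _)%N => x y w; clear; lia.
have avg_lt : (average_digit R J d' < average_digit R J (shifted e))%E.
  rewrite ltNge; apply/negP => le_avg.
  have W0R : 0 < W%:R :> R by rewrite ltr0n.
  (* The average of the chips has to be finite: between infinite averages the gap would be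
     invisible. *)
  have avg_N : (average_digit R J d' <= N%:R%:E)%E.
    by apply: (@average_digit_le _ _ _ _ 0%N) => k _; rewrite -natrM ler_nat.
  have := average_digit_ge0 R J d'.
  case avgE : (average_digit R J d') avg_N le_avg => [r||] // _ le_r _.
  (* The gap is 1 / W per place: half of it absorbs the constant C + s, and a quarter is left on
     either side of [r]. *)
  pose g : R := (4 * W%:R)^-1.
  have g0 : 0 < g by rewrite invr_gt0 mulr_gt0.
  have gW : g * W%:R = 1 / 4 by rewrite /g; field; rewrite gt_eqF.
  have [|n0 n00 hF] := @average_digit_lt R J (shifted e) (r + g).
    by apply: le_lt_trans le_r _; rewrite lte_fin ltrDl.
  have [n1 hn1] := archi_nat (2 * (C + s)%:R : R).
  have : (average_digit R J d' <= (r - g)%:E)%E.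
    apply: (@average_digit_le _ _ _ _ (maxn n0 (maxn n1 s.+1))) => k.
    rewrite !geq_max => /and3P[k0 k1 ks].
    have := gap k ltac:(by rewrite /a; clear -ks; lia).
    rewrite -(ler_nat R) !natrD !natrM -natrD.
    have := hn1 _ k1; have := ltW (hF _ k0).
    set x := (sum_upto J d' _)%:R; set y := (sum_upto J _ _)%:R.
    move=> h1 h2 h3; rewrite -(ler_pM2l W0R).
    have := ler_wpM2l (ltW W0R) h1.
    have -> : W%:R * ((r + g) * k%:R) = W%:R * r * k%:R + (g * W%:R) * k%:R by ring.
    have -> : W%:R * ((r - g) * k%:R) = W%:R * r * k%:R - (g * W%:R) * k%:R by ring.
    rewrite gW; lra.
  by rewrite avgE lee_fin; lra.
exists v; split=> //; rewrite /expansion_average_digit_at (beta_expansion_eq beta_gt1 v0 exp_d).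
by apply: le_lt_trans avg_lt; apply: ereal_inf_lbound; exists d'.
Qed.

(** For finite J, removing the first digit leaves a number v whose expansion over all integers has
    the same later digits, hence the same average; the optimality of that expansion bounds the
    minimal average of v instead of u, and the supremum absorbs the change of number. *)
Lemma reducible_expansions_optimal (R : realType) (beta : R) (J : option int) :
  1 < beta -> greedy_reducible beta ->
  min_average_digit J beta = expansion_average_digit J beta.
Proof.
move=> beta_gt1 red; apply/eqP; rewrite eq_le; apply/andP; split.
  apply: ge_ereal_sup => _ [u /= u0 <-].
  apply: (@le_trans _ _ (expansion_average_digit_at J beta u)).
    apply: ereal_inf_lbound; exists (beta_expansion J beta u) => //.
    by have [] := beta_expansionP beta_gt1 J u0.
  by apply: ereal_sup_ubound; exists u.
apply: ge_ereal_sup => _ [u /= u0 <-]; rewrite /expansion_average_digit_at.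
set d := beta_expansion J beta u.
have hd : is_beta_expansion J beta u d := beta_expansionP beta_gt1 J u0.
suff [v v0 hv] : exists2 v, 0 < v & forall d', beta_representation J beta v d' ->
    (average_digit R J d <= average_digit R J d')%E.
  apply: (@le_trans _ _ (min_average_digit_at J beta v)).
    by apply: le_ereal_inf_tmp => _ [d' /= rep <-]; apply: hv.
  by apply: ereal_sup_ubound; exists v.
case: J @d hd => [m|] d hd; last first.
  by exists u => // d'; apply: expansion_optimal.
have [[ds rep] rem] := hd.
have zd : zero_below (Some m) m d.
  by split=> j; [exact: ds | move=> /= /negP; rewrite -ltNge; apply: ds].
pose d0 (j : int) : nat := if j == m then 0%N else d j.
have z0 : zero_below None m d0.
  split=> j; last by move=> /(_ I).
  by rewrite /d0 => jm; case: eqP => // _; apply: ds.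
have d0S (i : nat) : d0 (m + i.+1%:Z) = d (m + i.+1%:Z).
  by rewrite /d0; case: eqP => // h; exfalso; clear -h; lia.
pose v := u - (d m)%:R * beta ^ (- m).
have sum0 n : \sum_(i < n.+1) (d0 (m + i%:Z))%:R * beta ^ (- (m + i%:Z)) =
    beta_sum (Some m) beta d (m + n%:Z) - (d m)%:R * beta ^ (- m).
  rewrite (beta_sum_shift _ _ zd) !big_ord_recl /= {1}/d0 addr0 eqxx mul0r add0r.
  by rewrite addrC addKr; apply: eq_bigr => i _; rewrite d0S.
have rem0 n : 0 <= v - \sum_(i < n.+1) (d0 (m + i%:Z))%:R * beta ^ (- (m + i%:Z))
                < beta ^ (- (m + n%:Z)).
  have := rem (m + n%:Z) ltac:(by rewrite /from /= lerDl).
  by rewrite sum0 /v opprB addrA subrK.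
have vm : 0 <= v < beta ^ (- m).
  by have := rem0 0%N; rewrite big_ord_recr big_ord0 /d0 /= addr0 eqxx mul0r addr0 subr0.
have cmp (k : nat) : (sum_upto (Some m) d k%:Z <= sum_upto None d0 k%:Z + d m)%N.
  have [km|mk] := ltP k%:Z m; first by rewrite (sum_digits_lt zd km).
  have -> : k%:Z = m + `|(k%:Z - m)%R|%N%:Z by clear -mk; lia.
  rewrite (sum_digits_shift _ zd) (sum_digits_shift _ z0) !big_ord_recl /=.
  rewrite addr0 addnC leq_add2r; apply: leq_trans (leq_addl _ _).
  by apply: leq_sum => i _; rewrite d0S.
have /andP[v_ge0 v_lt] := vm.
(* If nothing is left, the average is 0 and any positive number, such as 1, will do. *)
have [v0|v_neq0] := eqVneq v 0.
  exists 1; first exact: ltr01.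
  move=> d' _; apply: (@le_trans _ _ (average_digit R (Some m) (fun=> 0%N))).
    have dz n : d (m + n.+1%:Z) = 0%N.
      have := rem0 n.+1; rewrite v0 sub0r oppr_ge0 => /andP[+ _].
      move=> h; apply/eqP; rewrite -(pnatr_eq0 R).
      have e0 := expz_gt0 beta_gt1 (- (m + n.+1%:Z)).
      have : (d0 (m + n.+1%:Z))%:R * beta ^ (- (m + n.+1%:Z)) <= 0.
        apply: le_trans h; rewrite big_ord_recr /= lerDr.
        by apply: sumr_ge0 => i _; rewrite mulr_ge0 // ltW // expz_gt0.
      rewrite d0S.
      by rewrite pmulr_lle0 // => h2; rewrite eq_le h2 ler0n.
    apply: (@average_digit_le_add _ _ _ _ _ (d m)) => k.
    have [km|mk] := ltP k%:Z m; first by rewrite (sum_digits_lt zd km).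
    have -> : k%:Z = m + `|(k%:Z - m)%R|%N%:Z by clear -mk; lia.
    rewrite (sum_digits_shift _ zd) big_ord_recl /= addr0 big1 ?addn0 ?leq_addl //.
  by apply: (@average_digit_le_add _ _ _ _ _ 0%N) => k; rewrite /sum_upto fsbig1.
have v_gt0 : 0 < v by rewrite lt_def v_neq0.
have exp0 : is_beta_expansion None beta v d0.
  apply: (expansion_intro beta_gt1 z0) => // k _ km.
  rewrite v_ge0 /=; apply: lt_trans v_lt _; by rewrite ltr_eXz2l // ltrN2.
exists v => // d' rep'.
apply: (@le_trans _ _ (average_digit R None d0)).
  exact: average_digit_le_add cmp.
exact: expansion_optimal rep'.
Qed.

(** As a quadratic in y, the cofactor x^2 + x y + y^2 - 1 vanishes only if x^2 <= 4/3; then x + 1 =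
    x^3 <= 4 x / 3 would give x >= 3. *)
Lemma cubic_root_unique (R : realType) (x y : R) : 1 < x ->
  x ^+ 3 - x - 1 = 0 -> y ^+ 3 - y - 1 = 0 -> x = y.
Proof.
move=> x1 hx hy; apply/eqP; rewrite -subr_eq0.
have : (x - y) * (x ^+ 2 + x * y + y ^+ 2 - 1) = 0.
  have -> : (x - y) * (x ^+ 2 + x * y + y ^+ 2 - 1) =
     (x ^+ 3 - x - 1) - (y ^+ 3 - y - 1) by ring.
  by rewrite hx hy subrr.
move=> /eqP; rewrite mulf_eq0 => /orP[//|/eqP h].
exfalso.
have sq : 0 <= (2 * y + x) ^+ 2 by exact: sqr_ge0.
have x2 : x ^+ 2 <= 4 / 3.
  have e : (2 * y + x) ^+ 2 = 4 * (x ^+ 2 + x * y + y ^+ 2 - 1) + 4 - 3 * x ^+ 2 by ring.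
  move: sq; rewrite e h; lra.
have x0 : 0 < x by lra.
have := ler_wpM2l (ltW x0) x2.
have -> : x * x ^+ 2 = x ^+ 3 by ring.
have x3 : x < 2.
  rewrite ltNge; apply/negP => ge2.
  have := ler_pM (ler0n R 2) (ler0n R 2) ge2 ge2; rewrite -expr2; lra.
lra.
Qed.

Theorem theorem1 (R : realType) (beta : R) (hbeta : 1 < beta) (J : option int)
    (rho : R) (hrho : rho ^+ 3 - rho - 1 = 0) :
  (([set rho] `|` MB R) beta ->
     min_average_digit J beta = expansion_average_digit J beta) /\
  (~ ([set rho] `|` MB R) beta ->
     exists u : R, 0 < u /\
       (min_average_digit_at J beta u < expansion_average_digit_at J beta u)%E).
Proof.
split=> [h|h].
  apply: reducible_expansions_optimal => //.
  case: h => [/= e|/(MB_greedy_reducible hbeta)//].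
  apply: carry_greedy_reducible => //; apply: carry_property_rho => //.
  by rewrite e; lra.
apply: not_reducible_example => // red; apply: h.
have [[t1 [ps [data ps0]]]|b3] := reducible_bases hbeta red.
  by right; apply: unity_data_MB data ps0.
left; apply: cubic_root_unique hbeta _ hrho; lra.
Qed.
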